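(* The dual weight matrix $U^{(\lambda)}(n)=P_n^{(\lambda)}(0)^*(\mathcal H_n^{(\lambda)})^{-1}P_n^{(\lambda)}(0)$ for the matrix Charlier polynomials is $$U^{(\lambda)}(n)=a^{2n}L_0^*(I+A^* )^{-\lambda}\bigl(I+(\mathcal A_{n+\lambda})^*\bigr)^n(\mathcal D_n^{(\lambda)})^{-1}(I+\mathcal A_{n+\lambda})^n(I+A)^{-\lambda}L_0,$$ and, for each $\rho=\rho_i^{(\lambda)}$, $i\in\{1,2,3\}$ ($\lambda\ge1$ if $i=3$), it satisfies: (a) $\sum_{n=0}^\infty F(n)U^{(\lambda)}(n)<\infty$ (i.e. the series converges) for any matrix valued function $F$ with rational entries and no poles in $\mathbb N_0$; (b) $\lim_{n\to\infty}R_1(\rho(n))\,P_n^{(\lambda)}(0)\,(\mathcal H_n^{(\lambda)})^{-1}\,P_{n+1}^{(\lambda)}(0)^*\,R_2(\rho(n))=0$ for all $R_1,R_2\in M_N(\mathbb C)[n]$.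
   Context: $N\ge1$, $a>0$, $\lambda\in\mathbb N_0=\{0,1,2,\dots\}$, $n\in\mathbb N_0$. $\mu_1,\dots,\mu_N>0$ satisfy $(\mu_j/\mu_k)^2=a^{k-j}\frac{(N-k)!}{(N-j)!}$ and $\delta_k^{(\lambda)}=(a/2)^\lambda\frac{(\lambda+k-1)!}{(k-1)!}$. $A$ is the $N\times N$ matrix whose only nonzero entries are $A_{k+1,k}=\mu_{k+1}/\mu_k=\sqrt{(N-k)/a}$, $1\le k\le N-1$; $J=\mathrm{diag}(1,\dots,N)$; $T^{(\lambda)}=\mathrm{diag}(\delta_1^{(\lambda)},\dots,\delta_N^{(\lambda)})$; $L_0$ is lower triangular with $(L_0)_{jk}=\frac{\mu_j}{\mu_k}\frac{(-a)^{j-k}}{(j-k)!}$ for $j\ge k$. $W^{(\lambda)}(x)=\frac{a^x}{x!}(I+A)^{x+\lambda}T^{(\lambda)}(I+A^* )^{x+\lambda}$, $x\in\mathbb N_0$; $P_n^{(\lambda)}$ (the matrix Charlier polynomials) are the monic matrix polynomials, $\deg P_n^{(\lambda)}=n$, orthogonal for $\langle P,Q\rangle^{(\lambda)}=\sum_{x=0}^\infty P(x)W^{(\lambda)}(x)Q(x)^*$; $\mathcal H_n^{(\lambda)}=\langle P_n^{(\lambda)},P_n^{(\lambda)}\rangle^{(\lambda)}$; $\mathcal D_n^{(\lambda)}$ is the positive definite diagonal matrix with $\mathcal H_n^{(\lambda)}=L_0^{-1}(I+A)^{n+\lambda}\mathcal D_n^{(\lambda)}(I+A^* )^{n+\lambda}(L_0^*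 )^{-1}$. The matrices $P_n^{(\lambda)}(0)$ are invertible. $\mathcal A_s=((N+s)I-J)^{-1}JA^*$, i.e. the matrix whose only nonzero entries are $(\mathcal A_s)_{j,j+1}=\frac j{N+s-j}\sqrt{(N-j)/a}$, $1\le j\le N-1$ (used also for $s=0$). $\rho_1^{(\lambda)}(n)=P_n^{(\lambda)}(0)^{-1}\Gamma_n^{(\lambda)}P_n^{(\lambda)}(0)$ with $\Gamma_n^{(\lambda)}=a(I+A)-J-(n+\lambda)(I+A)^{-1}$; $\rho_2^{(\lambda)}(n)=nP_n^{(\lambda)}(0)^{-1}G_n^{(\lambda)}P_n^{(\lambda)}(0)$; $\rho_3^{(\lambda)}(n)=(n+1)P_n^{(\lambda)}(0)^{-1}G_{n+1}^{(\lambda-1)}P_n^{(\lambda)}(0)$ (for $\lambda\ge1$), where $G_n^{(\lambda)}=\frac12L_0^{-1}(I+A)^{n+\lambda}((N+\lambda+1)I-J)(I+A)^{-n-\lambda}L_0$. $M_N(\mathbb C)[n]$ denotes the $N\times N$ matrix polynomials; they are evaluated at a matrix with the variable on the left: $R(\mathcal N)=\sum_k\mathcal N^kA_k$. *)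

(* Defs.v *)
From HB Require Import structures.
From mathcomp Require Import all_boot all_order all_algebra.
From mathcomp Require Import all_classical all_reals all_analysis.
From mathcomp Require Import complex.
Import Order.TTheory GRing.Theory Num.Theory.
Import numFieldNormedType.Exports.

Set Implicit Arguments.
Unset Strict Implicit.
Unset Printing Implicit Defensive.

Local Open Scope classical_set_scope.
Local Open Scope ring_scope.
Local Open Scope complex_scope.
Local Open Scope sesquilinear_scope.

(* R[i] typed as a numClosedFieldType, so that the library's topology on numeric
   fields, and hence on matrices, is inferred for it. *)
Definition Cplx (R : realType) : numClosedFieldType := R[i].

Definition toC (R : realType) (x : R) : Cplx R := x%:C.

(* Throughout, N = m.+1 >= 1 and C = Cplx R. The mathematical index j in
   {1, ..., N} is rendered as j.+1 with j : 'I_N (so N - j reads N - j.+1 and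
   (j - 1)! reads j`!). N x N complex matrices are handled through their ring
   structure: 1 is the identity and n%:R the scalar matrix n I. *)

Section MatrixCharlier.
Variables (R : realType) (m : nat).
Local Notation N := m.+1.
Local Notation C := (Cplx R).
Local Notation M := 'M[C]_N.

Definition posdefmx (D : M) : Prop :=
  D^t* = D /\ forall v : 'cV[C]_N, v != 0 -> 0 < (v^t* *m D *m v) ord0 ord0.

(* Evaluation of a matrix polynomial at a matrix, with the variable on the
   left; poly.v's horner puts it on the right. *)
Definition lhorner (Q : {poly M}) (X : M) : M :=
  \sum_(k < size Q) X ^+ k * Q`_k.

Definition rational_without_poles (F : nat -> M) : Prop :=
  exists p q : 'I_N -> 'I_N -> {poly C}, forall n i j,
    (q i j).[n%:R] != 0 /\ F n i j = (p i j).[n%:R] / (q i j).[n%:R].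

Definition ip (W : nat -> M) (P Q : {poly M}) : M :=
  limn (series (fun x : nat => P.[x%:R] * W x * (Q.[x%:R])^t*)).

Definition monic_orthogonal (W : nat -> M) (P : nat -> {poly M}) : Prop :=
  (forall n, P n \is monic /\ size (P n) = n.+1) /\
  (forall n k, n != k -> ip W (P n) (P k) = 0).

Definition Jmx : M := diag_mx (\row_(j < N) (j.+1)%:R).

Variables (a : R) (mu : 'I_N -> R).

Definition mu_spec : Prop :=
  (forall j, 0 < mu j) /\
  (forall j k : 'I_N, (mu j / mu k) ^+ 2 =
     a ^ (k%:Z - j%:Z) * (((N - k.+1)`!)%:R / ((N - j.+1)`!)%:R)).

Definition Amx : M :=
  \matrix_(j, k) if j == k.+1 :> nat then toC (mu j / mu k) else 0.

Definition L0 : M :=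
  \matrix_(j, k) if (k <= j)%N
    then toC (mu j / mu k * ((- a) ^+ (j - k) / ((j - k)`!)%:R)) else 0.

Definition delta (lam : nat) (k : 'I_N) : R :=
  (a / 2) ^+ lam * (((lam + k)`!)%:R / (k`!)%:R).

Definition Tmx (lam : nat) : M := diag_mx (\row_(k < N) toC (delta lam k)).

Definition weight (lam x : nat) : M :=
  toC (a ^+ x / (x`!)%:R) *:
    ((1 + Amx) ^+ (x + lam) * Tmx lam * (1 + Amx^t*) ^+ (x + lam)).

(* J A^* scaled on the left by ((N + s) I - J)^-1, written entrywise so that
   it also makes sense for s = 0, where (N + s) I - J is singular. *)
Definition calA (s : nat) : M :=
  \matrix_(j, k) if k == j.+1 :> nat
    then toC ((j.+1)%:R / (N + s - j.+1)%:R * Num.sqrt ((N - j.+1)%:R / a))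
    else 0.

Definition Gamma (lam n : nat) : M :=
  toC a *: (1 + Amx) - Jmx - (n + lam)%:R *: (1 + Amx)^-1.

Definition Gmx (lam n : nat) : M :=
  2^-1 *: (L0^-1 * (1 + Amx) ^+ (n + lam) * ((N + lam + 1)%:R - Jmx)
             * (1 + Amx) ^- (n + lam) * L0).

Variables (lam : nat) (P : nat -> {poly M}).

Definition sqnorm (n : nat) : M := ip (weight lam) (P n) (P n).

Definition sqnorm_diagonal (D : nat -> M) : Prop :=
  forall n, [/\ is_diag_mx (D n), posdefmx (D n) &
    sqnorm n = L0^-1 * (1 + Amx) ^+ (n + lam) * D n
                 * (1 + Amx^t*) ^+ (n + lam) * (L0^t*)^-1].

Definition dual_weight (n : nat) : M :=
  ((P n).[0])^t* * (sqnorm n)^-1 * (P n).[0].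

Definition rho1 (n : nat) : M :=
  (P n).[0]^-1 * Gamma lam n * (P n).[0].

Definition rho2 (n : nat) : M :=
  n%:R *: ((P n).[0]^-1 * Gmx lam n * (P n).[0]).

(* Meaningful for 0 < lam only. *)
Definition rho3 (n : nat) : M :=
  (n.+1)%:R *: ((P n).[0]^-1 * Gmx lam.-1 n.+1 * (P n).[0]).

End MatrixCharlier.

(* Main.v *)
Require Import Defs.
From HB Require Import structures.
From mathcomp Require Import all_boot all_order all_algebra.
From mathcomp Require Import all_classical all_reals all_analysis.
From mathcomp Require Import complex ring.
Import Order.TTheory GRing.Theory Num.Theory.
Import numFieldNormedType.Exports.

Set Implicit Arguments.
Unset Strict Implicit.
Unset Printing Implicit Defensive.

Local Open Scope classical_set_scope.
Local Open Scope ring_scope.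
Local Open Scope sesquilinear_scope.

(** Write u = I + A, K = J A^t (A has real entries), and W_lam for the weight.
    Everything about P_n comes from a Rodrigues formula.

    Since [J, A] = A and [A, K] = (2 J - (N + 1)) / a, the matrices A, K and
    their commutator behave like an sl2 triple, so conjugation by u^s acts on J
    and K through polynomials in s.  Hence both W_(lam+1)(x) W_lam(x)^-1 and
    W_(lam+1)(x - 1) W_lam(x)^-1 are polynomials in x of degree 2
    ([weight_stay], [weight_back]), with the same quadratic coefficient.
    It follows that the n-th backward difference of W_(lam+n) is R_n W_lam for
    a polynomial R_n of degree n, called [rodrigues] below.  Summing by parts n
    times gives, for deg f <= n,
      <R_n, f> = (-1)^n n! (sum_x W_(lam+n)(x)) f_n^*
    ([ip_rodrigues]).  The leading coefficient r_n of R_n is the product of the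
    - Gmx (lam + n - k) k for k = 1, ..., n, hence invertible
    ([rod_lead_unit]), and uniqueness of monic orthogonal
    polynomials yields P_n = r_n^-1 R_n ([monic_rodrigues]).

    The value R_n(0) involves only W_(lam+n)(0) and W_lam(0), because the
    backward shifts vanish at 0; it is a product of n factors t + J + K.
    Conjugation by L0 = exp(- a A) turns t + J + K into N + t + 1 - J + K
    ([L0_conj]), and a product of such factors with consecutive t equals a
    diagonal matrix times (I + calA)^n ([L0_raise_prod]).  The diagonal matrix
    cancels against r_n, which leaves
      u^-(n+lam) L0 P_n(0) = (- a)^n (I + calA_(n+lam))^n u^-lam L0
    ([charlier_at0]) and therefore the formula for the dual weight.

    For the asymptotic statements, f = P_n in the summation by parts expresses
    D_n through the positive series sum_x W_(lam+n)(x); keeping only its term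
    at x = 0 bounds D_n^-1 by a^-n / n! times a power of n ([D_inv_bound]).
    Powers (I + X)^n and (I + X)^-n with X nilpotent grow polynomially in n, so
    P_n(0) is a^n, its inverse a^-n, and each rho(n) is 1, up to powers of n.
    The summands in (a) and the sequence in (b) are thus bounded by a^n / n!
    times a power of n, which is dominated by an exponential series. *)

(** * Noncommutative identities of sl2 type *)

Section Entries.
Variables (F : comNzRingType) (m : nat).
Local Notation M := 'M[F]_m.+1.
Implicit Types X Y : M.
Lemma entD X Y i j : (X + Y) i j = X i j + Y i j. Proof. by rewrite mxE. Qed.
Lemma entN X i j : (- X) i j = - X i j. Proof. by rewrite mxE. Qed.
Lemma entZ c X i j : (c *: X) i j = c * X i j. Proof. by rewrite mxE. Qed.
Definition entE := (entD, entN, entZ).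
Lemma scal_l c X Y : (c *: X) * Y = c *: (X * Y).
Proof. by rewrite scalerAl. Qed.
Lemma scal_r c X Y : X * (c *: Y) = c *: (X * Y).
Proof. by rewrite scalerAr. Qed.
(** Expands a noncommutative expression into a linear combination of words.  The
    words can then be treated as atoms: their entries lie in a commutative ring,
    where [mxring] and [mxfield] compare the two sides entry by entry. *)
Definition ncE := (@mulrDl M, @mulrDr M, @mulNr M, @mulrN M, scal_l, scal_r,
  @mulr1 M, @mul1r M, @mulrA M).
End Entries.

Ltac mxring := apply/matrixP => ? ?; rewrite ?entE; ring.
Ltac mxfield := apply/matrixP => ? ?; rewrite ?entE; field.

(** A and K play the raising and lowering operators of an sl2 triple, h their
    commutator, and J the grading, of which h is an affine function. *)
Section Sl2.
Variables (F : fieldType) (m : nat) (A J K : 'M[F]_m.+1) (a c : F).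
Local Notation M := 'M[F]_m.+1.
Hypothesis a0 : a != 0.
Variable h : M.
Hypothesis hE : h = a^-1 *: (2 *: J - c%:A).
Hypothesis JA : J * A = A * J + A.
Hypothesis AK : A * K = K * A + h.

Lemma J_powA k : J * A ^+ k = A ^+ k * J + k%:R *: A ^+ k.
Proof.
elim: k => [|k IH]; first by rewrite !expr0 scale0r addr0 mulr1 mul1r.
rewrite exprS mulrA JA mulrDl -mulrA IH -natr1.
by rewrite !ncE; mxring.
Qed.

Lemma A_h : A * h = h * A - (2 / a) *: A.
Proof. by rewrite hE !ncE JA; mxring. Qed.

(** Each of the k factors A that K crosses leaves one h; collecting these h on
    the left costs 2/a for every A crossed, in total (k(k - 1)/2)(2/a). *)
Lemma powA_K k : A ^+ k * K = K * A ^+ k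
  + k%:R *: (h * A ^+ k.-1) - (k%:R * (k%:R - 1) / a) *: A ^+ k.-1.
Proof.
elim: k => [|k IH].
  by rewrite !expr0 !mul0r !scale0r addr0 subr0 mulr1 mul1r.
rewrite exprS -mulrA IH mulrBr mulrDr (mulrA A K) AK !scal_r.
case: k {IH} => [|k].
  rewrite /= !expr0 !ncE; mxring.
rewrite -[k.+1.-1]/k -[k.+2.-1]/k.+1 (mulrA A h) A_h mulrBl -(mulrA h) scal_l.
rewrite -!(exprS A) mulrDl -mulrA -!(exprS A) -(natr1 k.+1) -(natr1 k).
by mxring.
Qed.

(** B is A u^-1, described without inverses. *)
Variables (u B : M).
Hypotheses (uE : u = 1 + A) (Bu : B * u = A) (uB : u * B = A).

Lemma u_J : u * J = (J - B) * u.
Proof. by rewrite mulrBl Bu uE !ncE JA; mxring. Qed.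

Lemma u_K : u * K = K * u + h.
Proof. by rewrite uE mulrDl AK mul1r mulrDr mulr1 addrA. Qed.

Lemma u_h : u * h = (h - (2 / a) *: B) * u.
Proof. by rewrite mulrBl !scal_l Bu uE mulrDl A_h !ncE; mxring. Qed.

Lemma upow_J s : u ^+ s * J = (J - s%:R *: B) * u ^+ s.
Proof.
elim: s => [|s IH]; first by rewrite !expr0 scale0r subr0 mulr1 mul1r.
rewrite exprS -mulrA IH mulrA mulrBr u_J scal_r uB -Bu -scal_l -mulrBl.
by rewrite -mulrA -natr1; congr (_ * _); mxring.
Qed.

Lemma upow_shift (d : F) s :
  u ^+ s * (d%:A - J) = (d%:A - J + s%:R *: B) * u ^+ s.
Proof. by rewrite mulrBr upow_J !ncE; mxring. Qed.

Lemma upow_shiftD (d : F) s :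
  u ^+ s * (d%:A + J) = (d%:A + J - s%:R *: B) * u ^+ s.
Proof. by rewrite mulrDr upow_J !ncE; mxring. Qed.

(** Conjugation by u^s is polynomial in s, of degree 2 on K: each factor u adds a
    conjugate of h to K, and these conjugates move linearly with s. *)
Lemma upow_conj (t : F) s :
  u ^+ s.+1 * (t%:A + J + K) =
    (u * (t%:A + J + K) - s%:R *: A + s%:R *: h
      - (s%:R * (s%:R + 1) / a) *: B) * u ^+ s.
Proof.
elim: s => [|s IH].
  by rewrite expr0 expr1 !mul0r !scale0r subr0 addr0 subr0 mulr1.
rewrite exprS -mulrA IH mulrA [u ^+ s.+1]exprS mulrA; congr (_ * _).
have uX : u * (t%:A + J + K) = (t%:A + J + K) * u - A + h.
  by rewrite !mulrDr u_J u_K mulrBl Bu !ncE; mxring.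
have uu : u * A = A * u by rewrite uE !ncE.
move: (t%:A + J + K) uX => X uX.
have uuX : u * (u * X) = (u * X - A + h - (2 / a) *: B) * u.
  by rewrite {1}uX mulrDr mulrBr u_h uu !ncE; mxring.
rewrite !(mulrBr, mulrDr) uuX !scal_r uu u_h uB -natr1 !ncE Bu.
by mxfield.
Qed.

(** The right-hand side is the multiplier of [upow_conj] at s = t + x; the left
    one is its expansion in powers of x, the form in which it is a polynomial
    with matrix coefficients.  [lowering_poly] does the same for
    [upow_shiftD]. *)
Lemma raising_poly (two : (2 : F) != 0) (X : M) (x t : F) :
  (a / 2) *: (X - t *: A + t *: h - (t * (t + 1) / a) *: B)
    + x *: ((a / 2) *: (h - A - ((2 * t + 1) / a) *: B))
    + x ^+ 2 *: - (2^-1 *: B)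
  = (a / 2) *: (X - (t + x) *: A + (t + x) *: h
      - ((t + x) * (t + x + 1) / a) *: B).
Proof. by mxfield; rewrite a0 two. Qed.

Lemma lowering_poly (X : M) (x t : F) :
  x *: (2^-1 *: (X - t *: B)) + x ^+ 2 *: - (2^-1 *: B)
  = (x / 2) *: (X - (t + x) *: B).
Proof. by mxring. Qed.

(** The multipliers of [raising_poly] and [lowering_poly] share the coefficient of
    x^2, so that their difference has degree 1 in x.  Its coefficient of x,
    corrected by the term that a backward difference of a polynomial of degree n
    contributes through x^2, is minus one half of the matrix that [exp_shift] and
    [upow_shift] conjugate to (c + t) - J. *)
Lemma leading_coef_eq (two : (2 : F) != 0) (t n : F) :
  (a / 2) *: (h - A - ((2 * t + 1) / a) *: B)
    - 2^-1 *: (t%:A + J - t *: B) - n *: (2^-1 *: B)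
  = - (2^-1 *: ((c + t)%:A - J + a *: A + (t + n + 1) *: B)).
Proof. by rewrite hE; mxfield; rewrite a0 two. Qed.

(** L is exp(- a A), a finite sum because A is nilpotent.  The sum includes the
    vanishing power A ^+ m.+1 so that shifting the index by one, as
    differentiation does, loses no term. *)
Section Exponential.
Variables (e : nat -> F) (L : M).
Hypotheses (AN : A ^+ m.+1 = 0) (e_succ : forall k, k.+1%:R * e k.+1 = - a * e k).
Hypothesis LE : L = \sum_(k < m.+2) e k *: A ^+ k.

Lemma exp_trunc : L = \sum_(k < m.+1) e k *: A ^+ k.
Proof. by rewrite LE big_ord_recr /= AN scaler0 addr0. Qed.

Lemma exp_deriv : \sum_(k < m.+2) (k%:R * e k) *: A ^+ k.-1 = - a *: L.
Proof.
rewrite big_ord_recl mul0r scale0r add0r exp_trunc scaler_sumr.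
by apply: eq_bigr => k _; rewrite scalerA /= /bump /= add1n e_succ.
Qed.

Lemma exp_euler : \sum_(k < m.+2) (k%:R * e k) *: A ^+ k = - a *: (A * L).
Proof.
rewrite scalerAr -exp_deriv mulr_sumr; apply: eq_bigr => -[[|k] hk] _ /=.
  by rewrite mul0r !scale0r mulr0.
by rewrite -scalerAr -exprS.
Qed.

Lemma exp_deriv2 :
  \sum_(k < m.+2) (k%:R * (k%:R - 1) * e k) *: A ^+ k.-1 = a ^+ 2 *: (A * L).
Proof.
rewrite big_ord_recl !mul0r scale0r add0r.
transitivity (- a *: \sum_(k < m.+1) (k%:R * e k) *: A ^+ k).
  rewrite scaler_sumr; apply: eq_bigr => k _; rewrite scalerA /= /bump /= add1n.
  by rewrite mulrAC e_succ -natr1 addrK; congr (_ *: _); ring.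
have := exp_euler; rewrite big_ord_recr /= AN scaler0 addr0 => ->.
by rewrite scalerA; congr (_ *: _); ring.
Qed.

Lemma exp_A : L * A = A * L.
Proof.
rewrite LE mulr_sumr mulr_suml; apply: eq_bigr => k _.
by rewrite scal_l scal_r -exprS exprSr.
Qed.

Lemma exp_J : L * J = (J + a *: A) * L.
Proof.
have JL : J * L = L * J + \sum_(k < m.+2) (k%:R * e k) *: A ^+ k.
  rewrite LE mulr_sumr mulr_suml -big_split /=; apply: eq_bigr => k _.
  by rewrite scal_r J_powA scalerDr scal_l scalerA [e k * _]mulrC.
by rewrite mulrDl scal_l JL exp_euler scaleNr subrK.
Qed.

Lemma exp_K : L * K = (K - a *: h - a *: A) * L.
Proof.
have -> : L * K = K * L + h * \sum_(k < m.+2) (k%:R * e k) *: A ^+ k.-1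
    - a^-1 *: \sum_(k < m.+2) (k%:R * (k%:R - 1) * e k) *: A ^+ k.-1.
  rewrite {1 2}LE mulr_suml !mulr_sumr scaler_sumr -big_split -sumrB /=.
  by apply: eq_bigr => k _; rewrite scal_l powA_K !scal_r; mxring.
by rewrite exp_deriv exp_deriv2 scal_r !mulrBl !scal_l; mxfield.
Qed.

(** Conjugating K by exp(- a A) produces - a h - a A, and conjugating J produces
    + a A: the two multiples of A cancel, while - a h = - 2 J + c reverses the
    sign of J. *)
Lemma exp_conj t : L * (t%:A + J + K) = ((c + t)%:A - J + K) * L.
Proof.
have ah : a *: h = 2 *: J - c%:A by rewrite hE scalerA divff // scale1r.
by rewrite !mulrDr exp_J exp_K ah !ncE; mxring.
Qed.

Lemma exp_B : u \is a GRing.unit -> L * B = B * L.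
Proof.
have uL : u * L = L * u by rewrite uE mulrDl mulrDr mul1r mulr1 exp_A.
by move=> uu; apply: (mulIr uu); rewrite -!mulrA Bu -uL mulrA Bu exp_A.
Qed.

Lemma exp_shift (d b : F) : u \is a GRing.unit ->
  L * (d%:A - J + a *: A + b *: B) = (d%:A - J + b *: B) * L.
Proof.
move=> uu; rewrite !(mulrDr, mulrDl) mulrN mulNr exp_J !scal_r exp_B // exp_A.
by rewrite !ncE; mxring.
Qed.

End Exponential.
End Sl2.

(** The relation between X and S is X S = (S - 1) X, so moving S to the left of
    (1 + X)^n costs n X (1 + X)^(n-1); this is the defect between S - n and S. *)
Section UnipotentFactor.
Variables (F : fieldType) (m : nat) (J K X S : 'M[F]_m.+1) (c : F).
Hypotheses (SE : S = c%:A - J) (KE : K = S * X) (XJ : X * J = J * X + X).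

Lemma unip_factor n :
  (1 + X) ^+ n * (S - n%:R%:A + K) = (S - n%:R%:A) * (1 + X) ^+ n.+1.
Proof.
have vS : (1 + X) * S = S * (1 + X) - X.
  by rewrite SE !(mulrBr, mulrDl) XJ !ncE; mxring.
have vX : (1 + X) * X = X * (1 + X) by rewrite !ncE.
have vE Y : (1 + X) * Y = Y + X * Y by rewrite mulrDl mul1r.
have -> : S - n%:R%:A + K = S * (1 + X) - n%:R%:A by rewrite KE !ncE; mxring.
move: (1 + X) vS vX vE => v vS vX vE.
have -> : forall k, v ^+ k * (S * v - n%:R%:A) =
    S * v ^+ k.+1 - k%:R *: (X * v ^+ k) - n%:R *: v ^+ k.
  elim=> [|k IH]; first by rewrite !expr0 scale0r subr0 expr1 !ncE.
  rewrite exprS -mulrA IH !mulrBr !scal_r !mulrA vS vX mulrBl.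
  by rewrite -!mulrA -!exprS -(natr1 k); mxring.
rewrite mulrBl scal_l mul1r [in n%:R *: v ^+ n.+1]exprS vE.
by mxring.
Qed.
End UnipotentFactor.

(** * Polynomials over a noncommutative ring *)

Section PolyShift.
Variable V : nzRingType.
Implicit Types (p q : {poly V}) (e z : V).

Lemma comp_poly_wide k p q : (size p <= k)%N ->
  p \Po q = \sum_(i < k) p`_i *: q ^+ i.
Proof.
move=> pk; rewrite comp_polyE (big_ord_widen k (fun i => p`_i *: q ^+ i)) //.
rewrite big_mkcond; apply: eq_bigr => i _; case: ltnP => // h.
by rewrite nth_default ?scale0r.
Qed.

Lemma horner_shift p e z : GRing.comm e z ->
  (p \Po ('X + e%:P)).[z] = p.[z + e].
Proof.
move=> ez; have cz : comm_poly ('X + e%:P) z.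
  by apply: comm_polyD; [exact: comm_polyX|rewrite /comm_poly hornerC].
rewrite comp_polyE horner_sum [RHS]horner_coef; apply: eq_bigr => i _.
by rewrite hornerZ horner_exp_comm // hornerD hornerX hornerC.
Qed.

Lemma coef_shift_exp e i j : (i <= j)%N ->
  (('X + e%:P) ^+ i - 'X^i)`_j = 0.
Proof.
elim: i j => [|i IH] j ij; first by rewrite subrr coef0.
rewrite !exprS mulrDl addrAC -mulrBr coefD coefXM coefCM.
case: j ij => // j ij; rewrite IH // add0r.
have /eqP := IH j.+1 (leqW ij); rewrite coefB coefXn subr_eq0 => /eqP ->.
by rewrite gtn_eqF // mulr0.
Qed.

Lemma coef_shift_exp_top e i :
  (('X + e%:P) ^+ i.+1 - 'X^(i.+1))`_i = e *+ i.+1.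
Proof.
elim: i => [|i IH]; first by rewrite !expr1 addrAC subrr add0r coefC.
rewrite !(exprS _ i.+1) mulrDl addrAC -mulrBr coefD coefXM coefCM IH.
have /eqP := coef_shift_exp e (leqnn i.+1).
rewrite coefB coefXn eqxx subr_eq0 => /eqP ->.
by rewrite mulr1 -mulrSr.
Qed.

Lemma size_shift_sub n p e : (size p <= n.+1)%N ->
  (size ((p \Po ('X + e%:P)) - p)%R <= n)%N.
Proof.
move=> pn; apply/leq_sizeP => j nj.
rewrite -{2}[p]comp_polyXr !(comp_poly_wide _ pn) -sumrB coef_sum big1 // => i _.
by rewrite -scalerBr coefZ coef_shift_exp ?mulr0 // (leq_trans _ nj) // -ltnS.
Qed.

Lemma coef_shift_sub n p e : (size p <= n.+2)%N ->
  ((p \Po ('X + e%:P)) - p)`_n = p`_n.+1 * e *+ n.+1.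
Proof.
move=> pn; rewrite -{2}[p]comp_polyXr !(comp_poly_wide _ pn) -sumrB coef_sum.
rewrite big_ord_recr big1 /= => [|i _]; last first.
  by rewrite -scalerBr coefZ coef_shift_exp ?mulr0 // -ltnS.
by rewrite add0r -scalerBr coefZ coef_shift_exp_top mulrnAr.
Qed.

Lemma size_mul_le a b p q : (size p <= a.+1)%N -> (size q <= b.+1)%N ->
  (size (p * q)%R <= (a + b).+1)%N.
Proof.
move=> pa qb; apply: leq_trans (size_polyMleq p q) _.
by rewrite -subn1 leq_subLR add1n -addSn -addnS leq_add.
Qed.

Lemma coefM_top a b p q : (size p <= a.+1)%N -> (size q <= b.+1)%N ->
  (p * q)`_(a + b) = p`_a * q`_b.
Proof.
move=> pa qb; have ha : (a < (a + b).+1)%N by rewrite ltnS leq_addr.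
rewrite coefM (bigD1 (Ordinal ha)) //= addKn big1 ?addr0 // => i ia.
have [lt_ia|lt_ai|eq_ia] := ltngtP (i : nat) a.
- by rewrite (nth_default 0 (s := q)) ?mulr0 // (leq_trans qb) // ltn_subRL ltn_add2r.
- by rewrite nth_default ?mul0r // (leq_trans pa).
- by rewrite -(inj_eq val_inj) /= eq_ia eqxx in ia.
Qed.

End PolyShift.

Section Quad.
Variable V : nzRingType.
Local Notation quad x y z := (x%:P + y%:P * 'X + z%:P * 'X^2).

Lemma coef_quad (x y z : V) k : (quad x y z)`_k =
  x * (k == 0)%:R + y * (k == 1)%:R + z * (k == 2)%:R.
Proof.
by rewrite !coefD !coefCM coefX coefXn coefC; case: eqP; rewrite ?mulr1 ?mulr0.
Qed.

Lemma size_quad (x y z : V) : (size (quad x y z) <= 3)%N.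
Proof.
apply/leq_sizeP => k hk; rewrite coef_quad.
by case: k hk => [|[|[|k]]] //= _; rewrite !mulr0 !addr0.
Qed.

(** The step of the Rodrigues recursion.  The two quadratic multipliers share
    their top coefficient z, so only their difference, of degree 1, meets p
    itself, while z meets p(X - 1) - p, whose degree is one less than that of
    p. *)
Lemma rodrigues_step (p : {poly V}) n (x y z t : V) : (size p <= n.+1)%N ->
  let q := p * quad x y z - (p \Po ('X + (-1)%:P)) * (t%:P * 'X + z%:P * 'X^2) in
  (size q <= n.+2)%N /\ q`_n.+1 = p`_n * (y - t) + p`_n * z *+ n.
Proof.
move=> sz; set b := t%:P * 'X + _; set s := quad x y z => q.
have bE : b = quad 0 t z by rewrite polyC0 add0r.
have qE : q = p * (s - b) - ((p \Po ('X + (-1)%:P)) - p) * b.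
  by rewrite /q mulrBr mulrBl opprB addrA subrK.
have size_sb : (size (s - b)%R <= 2)%N.
  apply/leq_sizeP => k hk; rewrite bE coefB !coef_quad.
  by case: k hk => [|[|k]] //= _; rewrite !mulr0 !add0r subrr.
have sb1 : (s - b)`_1 = y - t.
  by rewrite bE coefB !coef_quad /= !mulr0 !mulr1 !add0r !addr0.
have [dsz dtop] : (size (((p \Po ('X + (-1)%:P)) - p) * b)%R <= n.+2)%N /\
    (((p \Po ('X + (-1)%:P)) - p) * b)`_n.+1 = - (p`_n * z *+ n).
  have b3 : (size b <= 3)%N by rewrite bE size_quad.
  (* For n = 0 the difference is 0, and its coefficient of index n - 1 is void. *)
  case: n sz {q qE} => [|n] sz.
    have := size_shift_sub (-1) sz; rewrite leqn0 size_poly_eq0 => /eqP ->.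
    by rewrite mul0r size_poly0 coef0 mulr0n oppr0.
  have sz' := size_shift_sub (-1) sz.
  have -> : n.+2 = (n + 2)%N by rewrite addn2.
  split; first exact: size_mul_le.
  rewrite (coefM_top sz' b3) (coef_shift_sub _ sz) bE coef_quad /=.
  by rewrite !mulr0 !add0r mulr1 mulrN1 mulNrn mulNr mulrnAl.
rewrite qE coefB dtop opprK -{2}[n.+1]addn1 (coefM_top sz size_sb) sb1; split=> //.
rewrite (leq_trans (size_polyD _ _)) // size_polyN geq_max dsz andbT.
by have := size_mul_le sz size_sb; rewrite addn1.
Qed.

End Quad.

Lemma horner_natM (V : nzRingType) (p q : {poly V}) (n : nat) :
  (p * q).[n%:R] = p.[n%:R] * q.[n%:R].
Proof. by rewrite hornerM_comm //; exact: commr_sym (commr_nat _ _). Qed.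

Lemma mul_natmx (F : comNzRingType) (m : nat) (X : 'M[F]_m.+1) (n : nat) :
  X * n%:R = n%:R *: X.
Proof. by rewrite mulr_natr scaler_nat. Qed.

Lemma horner_quad (F : comNzRingType) (m : nat) (c0 c1 c2 : 'M[F]_m.+1) (x : nat) :
  (c0%:P + c1%:P * 'X + c2%:P * 'X^2).[x%:R]
  = c0 + x%:R *: c1 + (x%:R ^+ 2) *: c2.
Proof.
rewrite !hornerD !horner_natM !hornerC !hornerX -natrM !mul_natmx.
by rewrite expr2 natrM.
Qed.

(** G1 is the backward shift of G extended by 0, so the boundary term at 0 does not
    appear. *)
Lemma sum_by_parts (V : nzRingType) (G F : nat -> V) n :
  let G1 x := if x is y.+1 then G y else 0 in
  \sum_(0 <= x < n) (G x - G1 x) * F x =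
  G1 n * F n - \sum_(0 <= x < n) G x * (F x.+1 - F x).
Proof.
elim: n => [|n IH] /=; first by rewrite !big_geq // mul0r subr0.
rewrite !big_nat_recr //= IH mulrBl mulrBr.
rewrite addrC subrKA [in RHS]opprD opprB [RHS]addrCA [in RHS](addrC (G n * _)).
by rewrite subrK addrC.
Qed.

(** * Real scalars inside the complex numbers *)

Section RealScalars.
Variable R : realType.
Local Notation C := (Cplx R).
Implicit Types x y : R.

Lemma toC0 : toC 0 = 0 :> C. Proof. exact: (rmorph0 (real_complex R)). Qed.
Lemma toC1 : toC 1 = 1 :> C. Proof. exact: (rmorph1 (real_complex R)). Qed.
Lemma toCD x y : toC (x + y) = toC x + toC y.
Proof. exact: (rmorphD (real_complex R)). Qed.
Lemma toCN x : toC (- x) = - toC x.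
Proof. exact: (rmorphN (real_complex R)). Qed.
Lemma toCM x y : toC (x * y) = toC x * toC y.
Proof. exact: (rmorphM (real_complex R)). Qed.
Lemma toCX x n : toC (x ^+ n) = toC x ^+ n.
Proof. exact: (rmorphXn (real_complex R)). Qed.
Lemma toCV x : toC x^-1 = (toC x)^-1.
Proof. exact: (fmorphV (real_complex R)). Qed.
Lemma toC_nat n : toC n%:R = n%:R :> C.
Proof. exact: (rmorph_nat (real_complex R)). Qed.
Lemma toC_sum I (r : seq I) (Q : pred I) (F : I -> R) :
  toC (\sum_(i <- r | Q i) F i) = \sum_(i <- r | Q i) toC (F i).
Proof. exact: (rmorph_sum (real_complex R)). Qed.
Lemma toC_eq0 x : (toC x == 0) = (x == 0).
Proof. exact: (fmorph_eq0 (real_complex R)). Qed.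
Lemma toC_le x y : (toC x <= toC y) = (x <= y).
Proof. exact: lecR. Qed.
Lemma toC_lt x y : (toC x < toC y) = (x < y).
Proof. exact: ltcR. Qed.
Lemma toC_ge0 x : (0 <= toC x) = (0 <= x).
Proof. by rewrite -toC0 toC_le. Qed.
Lemma toC_norm x : `|toC x| = toC `|x|.
Proof.
have [x0|x0] := lerP 0 x; first by rewrite !ger0_norm ?toC_ge0.
by rewrite !ltr0_norm -?toCN // -toC0 toC_lt.
Qed.
Lemma toC_conj x : (toC x)^* = toC x.
Proof. by apply/CrealP; apply/complex_realP; exists x. Qed.

Lemma real_toC (z : C) : z \is Num.real -> exists x, z = toC x.
Proof. by move/complex_realP => [x ->]; exists x. Qed.

End RealScalars.

(** * Sequences of matrices of controlled growth *)

Lemma leq_wexp2r p q e : (p <= q -> p ^ e <= q ^ e)%N.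
Proof. by case: e => // e; rewrite leq_exp2r. Qed.

Section Growth.
Variables (R : realType) (m : nat).
Local Notation C := (Cplx R).
Local Notation M := 'M[C]_m.+1.
Implicit Types (w v : nat -> R) (X Y : nat -> M).

(** X is bounded entrywise by w up to a polynomial factor in n.  The constants are
    natural numbers so that they remain real and nonnegative when the bound is
    read in the complex numbers. *)
Definition growth w X : Prop :=
  exists K d : nat, forall n i j, `|X n i j| <= toC ((K * n.+1 ^ d)%:R * w n).

Lemma complex_bound (z : C) : exists K : nat, `|z| <= toC K%:R.
Proof.
have [x ->] := real_toC (normr_real z).
exists (Num.bound `|x|); rewrite toC_le.
by rewrite ltW // (le_lt_trans (ler_norm x)) // archi_boundP.
Qed.

Lemma growth_cst (B : M) : growth (fun=> 1) (fun=> B).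
Proof.
have [K hK] : exists K : nat, forall ij : 'I_m.+1 * 'I_m.+1, `|B ij.1 ij.2| <= toC K%:R.
  have [K hK] := choice (fun ij : 'I_m.+1 * 'I_m.+1 => complex_bound (B ij.1 ij.2)).
  exists (\sum_ij K ij)%N => ij; apply: le_trans (hK ij) _.
  by rewrite toC_le ler_nat (bigD1 ij) //= leq_addr.
exists K, 0 => n i j; rewrite expn0 muln1 mulr1.
exact: (hK (i, j)).
Qed.

Lemma growthD w X Y : (forall n, 0 <= w n) ->
  growth w X -> growth w Y -> growth w (fun n => X n + Y n).
Proof.
move=> w0 [K1 [d1 h1]] [K2 [d2 h2]]; exists (K1 + K2)%N, (d1 + d2)%N => n i j.
rewrite mxE (le_trans (ler_normD _ _)) // (le_trans (lerD (h1 n i j) (h2 n i j))) //.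
rewrite -toCD toC_le -mulrDl ler_wpM2r // -natrD ler_nat mulnDl.
by apply: leq_add; rewrite leq_mul2l leq_pexp2l ?leq_addr ?leq_addl ?orbT.
Qed.

Lemma growthM w v X Y : (forall n, 0 <= w n) -> (forall n, 0 <= v n) ->
  growth w X -> growth v Y -> growth (fun n => w n * v n) (fun n => X n * Y n).
Proof.
move=> w0 v0 [K1 [d1 h1]] [K2 [d2 h2]].
(* An entry of the product is a sum of m.+1 products of entries. *)
exists (m.+1 * (K1 * K2))%N, (d1 + d2)%N => n i j.
rewrite mxE (le_trans (ler_norm_sum _ _ _)) //.
apply: (@le_trans _ _ (\sum_(k < m.+1)
   toC ((K1 * K2 * n.+1 ^ (d1 + d2))%:R * (w n * v n)))).
  apply: ler_sum => k _; rewrite normrM.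
  apply: le_trans (ler_pM _ _ (h1 n i k) (h2 n k j)) _ => //.
  by rewrite -toCM toC_le mulrACA -natrM mulnACA -expnD.
rewrite sumr_const card_ord -[_ *+ m.+1]mulr_natl -toC_nat -toCM toC_le.
by rewrite mulrA -natrM mulnA.
Qed.

Lemma eq_growth w v X Y : (forall n, w n = v n) -> (forall n, X n = Y n) ->
  growth w X -> growth v Y.
Proof.
by move=> wv XY [K [d h]]; exists K, d => n i j; rewrite -wv -XY.
Qed.

Lemma growthZ w v (c : nat -> C) X : (forall n, 0 <= w n) ->
  (forall n, `|c n| <= toC (v n)) ->
  growth w X -> growth (fun n => v n * w n) (fun n => c n *: X n).
Proof.
move=> w0 cv [K [d h]]; exists K, d => n i j; rewrite mxE normrM.
by rewrite mulrCA toCM ler_pM.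
Qed.

Lemma growthMn w X : (forall n, 0 <= w n) ->
  growth w X -> growth w (fun n => n%:R *: X n).
Proof.
move=> w0 [K [d h]]; exists K, d.+1 => n i j; rewrite mxE normrM normr_nat.
have -> : toC ((K * n.+1 ^ d.+1)%:R * w n)
    = n.+1%:R * toC ((K * n.+1 ^ d)%:R * w n).
  by rewrite -toC_nat -toCM mulrA -natrM expnS mulnCA.
by apply: ler_pM => //; rewrite ler_nat.
Qed.

Lemma growth_adj w X : growth w X -> growth w (fun n => (X n)^t*).
Proof.
by move=> [K [d h]]; exists K, d => n i j; rewrite !mxE norm_conjC.
Qed.

Lemma growth_sum (I : Type) (r : seq I) w (X_ : I -> nat -> M) :
  (forall n, 0 <= w n) -> (forall i, growth w (X_ i)) ->
  growth w (fun n => \sum_(i <- r) X_ i n).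
Proof.
move=> w0 hX; elim: r => [|i r IH].
  by exists 0, 0 => n i j; rewrite big_nil mxE normr0 mul0n mul0r toC0.
apply: eq_growth (growthD w0 (hX i) IH) => // n.
by rewrite big_cons.
Qed.

Lemma growth_bounded w (c : nat -> C) (K : nat) X : (forall n, 0 <= w n) ->
  (forall n, `|c n| <= toC K%:R) ->
  growth w X -> growth w (fun n => c n *: X n).
Proof.
move=> w0 cK [K' [d h]]; exists (K * K')%N, d => n i j; rewrite mxE normrM.
by rewrite -mulnA natrM -mulrA toCM ler_pM.
Qed.

Lemma growthX k X : growth (fun=> 1) X -> growth (fun=> 1) (fun n => X n ^+ k).
Proof.
move=> hX; elim: k => [|k IH].
  by apply: eq_growth (growth_cst 1) => // n; rewrite expr0.
apply: eq_growth (growthM _ _ hX IH) => // n; first by rewrite mulr1.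
by rewrite exprS.
Qed.

Lemma growth_shift w X : growth w X -> growth (fun n => w n.+1) (fun n => X n.+1).
Proof.
move=> [K [d h]]; exists (K * 2 ^ d)%N, d => n i j.
have w0 : 0 <= (K * n.+2 ^ d)%:R * w n.+1.
  by rewrite -toC_ge0; apply: le_trans (h n.+1 i j).
have [K0|K0] := posnP K; first by have := h n.+1 i j; rewrite K0 !mul0n.
apply: le_trans (h _ _ _) _; rewrite toC_le ler_wpM2r //.
  by move: w0; rewrite pmulr_rge0 // ltr0n muln_gt0 K0 expn_gt0.
rewrite ler_nat -mulnA leq_mul2l -expnMn leq_wexp2r ?orbT //.
by rewrite mul2n -addnn addSnnS leq_addl.
Qed.
End Growth.

Lemma growth_le (R : realType) (m : nat) (w v : nat -> R)
    (X : nat -> 'M[Cplx R]_m.+1) (c : R) :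
  (forall n, 0 <= v n) -> (forall n, w n <= c * v n) -> growth w X -> growth v X.
Proof.
move=> v0 wv [k [d h]]; pose c' := Num.bound `|c|.
have cc' : c <= c'%:R by rewrite ltW // (le_lt_trans (ler_norm c)) // archi_boundP.
exists (k * c')%N, d => n i j; apply: le_trans (h n i j) _; rewrite toC_le.
rewrite mulnAC [in leRHS]natrM -mulrA ler_wpM2l // (le_trans (wv n)) //.
by rewrite ler_wpM2r.
Qed.

Lemma bin_le_exp n k : ('C(n, k) <= n.+1 ^ k)%N.
Proof.
elim: n k => [|n IH] [|k]; rewrite ?bin0 ?bin0n // binS.
apply: leq_trans (leq_add (IH _) (IH _)) _.
by rewrite expnS -mulSnr expnS leq_mul2l leq_wexp2r ?orbT.
Qed.

Section Unipotent.
Variables (V : unitRingType) (N : nat) (x : V).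
Hypothesis xN : x ^+ N = 0.

Lemma nilp_exp_ge k : (N <= k)%N -> x ^+ k = 0.
Proof. by move=> /subnK <-; rewrite exprD xN mulr0. Qed.

Lemma unip_exp n : (1 + x) ^+ n = \sum_(k < N) x ^+ k *+ 'C(n, k).
Proof.
rewrite exprDn_comm; last exact: commr_sym (commr1 x).
under eq_bigr do rewrite expr1n mul1r.
rewrite (big_ord_widen (n.+1 + N) (fun k => x ^+ k *+ 'C(n, k))) ?leq_addr //.
rewrite [RHS](big_ord_widen (n.+1 + N) (fun k => x ^+ k *+ 'C(n, k))) ?leq_addl //.
rewrite big_mkcond [RHS]big_mkcond /=; apply: eq_bigr => k _.
case: ltnP => h1; case: ltnP => h2 //; first by rewrite nilp_exp_ge ?mul0rn.
by rewrite bin_small.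
Qed.

Lemma unip_mul_geom : (1 + x) * \sum_(k < N) (- x) ^+ k = 1.
Proof.
by have := subrX1 (- x) N; rewrite exprNn xN mulr0 sub0r => /eqP;
   rewrite eqr_oppLR -mulNr opprD !opprK addrC => /eqP <-.
Qed.

Lemma unip_geom_mul : (\sum_(k < N) (- x) ^+ k) * (1 + x) = 1.
Proof.
rewrite -[RHS]unip_mul_geom mulrDl mulrDr mul1r mulr1; congr (_ + _).
rewrite mulr_sumr mulr_suml; apply: eq_bigr => k _.
by apply: commr_sym; apply: commrX; apply: commrN.
Qed.

Lemma unip_unit : 1 + x \is a GRing.unit.
Proof. by apply/unitrP; exists (\sum_(k < N) (- x) ^+ k); split;
  [exact: unip_geom_mul|exact: unip_mul_geom]. Qed.

Lemma unip_inv : (1 + x)^-1 = \sum_(k < N) (- x) ^+ k.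
Proof.
by apply: (mulrI unip_unit); rewrite unip_mul_geom divrr // unip_unit.
Qed.

Lemma unip_inv_sub1 : exists2 y, y ^+ N = 0 & (1 + x)^-1 = 1 + y.
Proof.
exists (- x * (1 + x)^-1); last first.
  apply: (mulIr unip_unit); rewrite mulrDl mulVr ?unip_unit // -mulrA.
  by rewrite mulVr ?unip_unit // mulr1 mul1r addrK.
have cx : GRing.comm (- x) (1 + x)^-1.
  by apply/commrV/commrD; [exact: commr1|apply/commr_sym/commrN].
by rewrite (exprMn_comm N cx) exprNn xN mulr0 mul0r.
Qed.

End Unipotent.

Section GrowthUnipotent.
Variables (R : realType) (m : nat).
Local Notation C := (Cplx R).
Local Notation M := 'M[C]_m.+1.
Variable X : nat -> M.
Hypotheses (XN : forall n, X n ^+ m.+1 = 0) (gX : growth (fun=> 1) X).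

Lemma growthN w (Y : nat -> M) : growth w Y -> growth w (fun n => - Y n).
Proof. by move=> [K [d h]]; exists K, d => n i j; rewrite mxE normrN. Qed.

Lemma growthMexp w k (Y : nat -> M) : (forall n, 0 <= w n) ->
  growth w Y -> growth w (fun n => (n%:R ^+ k) *: Y n).
Proof.
move=> w0 gY; elim: k => [|k IH].
  by apply: eq_growth gY => // n; rewrite expr0 scale1r.
by apply: eq_growth (growthMn w0 IH) => // n; rewrite scalerA exprS.
Qed.

(** The binomial expansion of (1 + X_n)^n stops at the nilpotency order, which does
    not depend on n, and its coefficients are polynomial in n. *)
Lemma growth_unip_exp : growth (fun=> 1) (fun n => (1 + X n) ^+ n).
Proof.
have gk k : growth (fun=> 1) (fun n => X n ^+ k *+ 'C(n, k)).
  have [K [d h]] := growthX k gX; exists K, (k + d)%N => n i j.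
  rewrite mulmxnE normrMn -[leLHS]mulr_natl -toC_nat mulr1.
  apply: le_trans (ler_wpM2l _ (h n i j)) _; first by rewrite toC_ge0.
  rewrite -toCM toC_le mulr1 -natrM ler_nat expnD mulnCA leq_mul2l.
  by rewrite leq_mul2r bin_le_exp !orbT.
apply: eq_growth (growth_sum (index_enum 'I_m.+1) _ gk) => // n.
by rewrite (unip_exp (XN n)).
Qed.

Lemma growth_unip_inv : growth (fun=> 1) (fun n => (1 + X n)^-1).
Proof.
apply: eq_growth (growth_sum (index_enum 'I_m.+1) _
  (fun k : 'I_m.+1 => growthX k (growthN gX))) => // n.
by rewrite (unip_inv (XN n)).
Qed.

End GrowthUnipotent.

Section GrowthUnipotentInv.
Variables (R : realType) (m : nat).
Local Notation C := (Cplx R).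
Local Notation M := 'M[C]_m.+1.

Lemma growth_unip_expN (X : nat -> M) : (forall n, X n ^+ m.+1 = 0) ->
  growth (fun=> 1) X -> growth (fun=> 1) (fun n => (1 + X n) ^- n).
Proof.
move=> XN gX.
have gY : growth (fun=> 1) (fun n => (1 + X n)^-1 - 1).
  by apply: growthD => //; [exact: growth_unip_inv|exact: growth_cst].
have YN n : ((1 + X n)^-1 - 1) ^+ m.+1 = 0.
  by have [y yN ->] := unip_inv_sub1 (XN n); rewrite addrC addKr.
apply: eq_growth (growth_unip_exp YN gY) => // n.
by rewrite addrC subrK exprVn.
Qed.

Lemma growth_horner (P : {poly M}) : growth (fun=> 1) (fun x => P.[x%:R]).
Proof.
have gk k : growth (fun=> 1) (fun x : nat => (x%:R ^+ k) *: P`_k).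
  by apply: growthMexp => //; exact: growth_cst.
apply: eq_growth (growth_sum (index_enum 'I_(size P)) _
  (fun k : 'I_(size P) => gk k)) => // n.
rewrite horner_coef; apply: eq_bigr => k _.
by rewrite -natrX -natrX scaler_nat mulr_natr.
Qed.

(** |n - z| >= 1 as soon as n >= |z| + 1, and finitely many n remain. *)
Lemma inv_sub_nat_bounded (z : C) : (forall n : nat, n%:R != z) ->
  exists K : nat, forall n : nat, `|(n%:R - z)^-1| <= toC K%:R.
Proof.
move=> zN; have [n0 hn0] := complex_bound z.
have [K hK] := choice (fun n : nat => complex_bound (n%:R - z)^-1).
exists (1 + \sum_(i < n0.+1) K i)%N => n; rewrite toC_nat natrD.
have [nn0|nn0] := ltnP n n0.+1.
  apply: le_trans (hK n) _; rewrite toC_nat -natrD ler_nat.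
  by rewrite (bigD1 (Ordinal nn0)) //= addnCA leq_addr.
rewrite (@le_trans _ _ 1) ?lerDl ?ler0n // normfV invf_le1; last first.
  by rewrite normr_gt0 subr_eq0.
rewrite -(@lerD2r _ `|z|) (@le_trans _ _ n%:R) //; last first.
  by rewrite -[leLHS]normr_nat -{1}(subrK z n%:R) ler_normD.
rewrite (le_trans (lerD (lexx 1) hn0)) // toC_nat nat1r ler_nat.
exact: nn0.
Qed.

(** Over the complex numbers q splits into linear factors, none of which vanishes
    at a natural number. *)
Lemma inv_poly_bounded (q : {poly C}) : (forall n : nat, q.[n%:R] != 0) ->
  exists K : nat, forall n : nat, `|q.[n%:R]^-1| <= toC K%:R.
Proof.
have [r ->] := closed_field_poly_normal q.
set c := lead_coef q.
elim: r => [|z r IH] hq.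
  have [K hK] := complex_bound c^-1; exists K => n.
  by rewrite big_nil hornerZ hornerC mulr1.
have hq' n : (c *: \prod_(z <- r) ('X - z%:P)).[n%:R] != 0.
  apply: contra_neq (hq n); rewrite big_cons !hornerZ hornerM => h.
  by rewrite mulrCA h mulr0.
have [K1 h1] := IH hq'.
have [|K2 h2] := @inv_sub_nat_bounded z.
  move=> n; apply: contra_neq (hq n) => ->.
  by rewrite big_cons hornerZ hornerM hornerXsubC subrr mul0r mulr0.
exists (K2 * K1)%N => n.
rewrite big_cons hornerZ hornerM hornerXsubC mulrCA -hornerZ invfM normrM.
by rewrite natrM toCM ler_pM.
Qed.

Lemma growth_rational (F : nat -> M) : rational_without_poles F ->
  growth (fun=> 1) F.
Proof.
move=> [p [q hF]].
have gij ij : growth (fun=> 1)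
    (fun n => F n ij.1 ij.2 *: (delta_mx ij.1 ij.2 : M)).
  have [|K hK] := @inv_poly_bounded (q ij.1 ij.2).
    by move=> n; case: (hF n ij.1 ij.2).
  have gk k : growth (fun=> 1) (fun n : nat =>
      n%:R ^+ k *: ((p ij.1 ij.2)`_k *: (delta_mx ij.1 ij.2 : M))).
    by apply: growthMexp => //; exact: growth_cst.
  apply: eq_growth (growth_bounded _ hK (growth_sum
    (index_enum 'I_(size (p ij.1 ij.2))) _
     (fun k : 'I_(size (p ij.1 ij.2)) => gk k))) => // n.
  case: (hF n ij.1 ij.2) => _ ->; rewrite [_ / _]mulrC -scalerA; congr (_ *: _).
  rewrite horner_coef scaler_suml; apply: eq_bigr => k _.
  by rewrite scalerA mulrC.
apply: eq_growth (growth_sum (index_enum _) _ gij) => // n.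
by rewrite [RHS]matrix_sum_delta pair_bigA.
Qed.

End GrowthUnipotentInv.

Section GrowthProducts.
Variables (R : realType) (m : nat).
Implicit Types (w : nat -> R) (X Y : nat -> 'M[Cplx R]_m.+1).

Lemma exp_term_ge0 (c : R) : 0 <= c -> forall n, 0 <= c ^+ n / n`!%:R.
Proof. by move=> c0 n; rewrite divr_ge0 // exprn_ge0. Qed.

Lemma growth_polyMl w X Y : (forall n, 0 <= w n) ->
  growth (fun=> 1) X -> growth w Y -> growth w (fun n => X n * Y n).
Proof.
by move=> w0 gX gY; apply: eq_growth (growthM _ w0 gX gY) => // n; exact: mul1r.
Qed.

Lemma growth_polyMr w X Y : (forall n, 0 <= w n) ->
  growth w X -> growth (fun=> 1) Y -> growth w (fun n => X n * Y n).
Proof.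
by move=> w0 gX gY; apply: eq_growth (growthM w0 _ gX gY) => // n; exact: mulr1.
Qed.

Lemma growth_lhorner (Q : {poly 'M[Cplx R]_m.+1}) X : growth (fun=> 1) X ->
  growth (fun=> 1) (fun n => lhorner Q (X n)).
Proof.
move=> gX; apply: growth_sum => // k.
by apply: growth_polyMr => //; [exact: growthX|exact: growth_cst].
Qed.

End GrowthProducts.

(** * Limits of matrix sequences *)

Section MatrixLimits.
Variables (R : realType) (m : nat).
Local Notation C := (Cplx R).
Local Notation M := 'M[C]_m.+1.
Implicit Types (X Y : nat -> M).

Lemma cvg_mxP X (L : M) :
  (X n @[n --> \oo] --> L) <-> forall i j, X n i j @[n --> \oo] --> L i j.
Proof.
split=> [XL i j|XL].
  exact: (cvg_comp _ _ XL (@coord_continuous C _ _ i j L)).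
move=> A [Q LQ QA]; rewrite /nbhs /=.
have : \forall n \near \oo, forall ij : 'I_m.+1 * 'I_m.+1, Q ij.1 ij.2 (X n ij.1 ij.2).
  by apply: filter_forall => -[i j]; exact: XL (LQ i j).
by apply: filterS => n Qn; apply: QA => i j; exact: (Qn (i, j)).
Qed.

Lemma cvg_mxMl (B : M) X (L : M) :
  X n @[n --> \oo] --> L -> B * X n @[n --> \oo] --> B * L.
Proof.
move=> /cvg_mxP XL; apply/cvg_mxP => i j.
rewrite mxE; under eq_cvg do rewrite mxE.
apply: (@cvg_big _ _ +%R 0) => [|k _]; first by apply: add_continuous.
by apply: cvgMr; exact: XL.
Qed.

Lemma cvg_mxMr (B : M) X (L : M) :
  X n @[n --> \oo] --> L -> X n * B @[n --> \oo] --> L * B.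
Proof.
move=> /cvg_mxP XL; apply/cvg_mxP => i j.
rewrite mxE; under eq_cvg do rewrite mxE.
apply: (@cvg_big _ _ +%R 0) => [|k _]; first by apply: add_continuous.
by apply: cvgMl; exact: XL.
Qed.

Lemma cvg_toC (u : nat -> R) (l : R) :
  u n @[n --> \oo] --> l -> toC (u n) @[n --> \oo] --> (toC l : C).
Proof.
move=> ul; apply/cvgrPdist_lt => e e0.
have [e' ee'] := real_toC (gtr0_real e0).
have e'0 : 0 < e' by rewrite -toC_lt toC0 -ee'.
move/cvgrPdist_lt : ul => /(_ _ e'0); apply: filterS => n.
by rewrite -toCN -toCD toC_norm ee' toC_lt.
Qed.

(** Real and imaginary parts are absolutely convergent real series. *)
Lemma cvg_series_dominated (u : nat -> C) (b : nat -> R) :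
  (forall n, `|u n| <= toC (b n)) -> cvgn (series b) -> cvgn (series u).
Proof.
move=> ub cb.
have real_part (f : C -> R) : (forall z, `|toC (f z)| <= `|z|) ->
    cvgn (series (fun n => f (u n))).
  move=> hf; apply: normed_cvg; apply: series_le_cvg cb => n /=.
  - exact: normr_ge0.
  - by rewrite -toC_ge0; apply: le_trans (ub n).
  by rewrite -toC_le -toC_norm; apply: le_trans (hf _) (ub n).
have cRe : cvgn (series (fun n => complex.Re (u n))).
  by apply: real_part => z; rewrite toC_norm; exact: normc_ge_Re.
have cIm : cvgn (series (fun n => complex.Im (u n))).
  apply: real_part => z; have := normc_ge_Re ('i%C * z).
  rewrite normrM normCi mul1r toC_norm; case: z => x y /=.
  by rewrite mul0r mul1r sub0r normrN.
apply/cvg_ex; exists (toC (limn (series (fun n => complex.Re (u n)))) +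
  'i * toC (limn (series (fun n => complex.Im (u n))))).
have -> : series u = fun n => toC (series (fun n => complex.Re (u n)) n) +
  'i * toC (series (fun n => complex.Im (u n)) n).
  apply/funext => n; rewrite /series /= !toC_sum mulr_sumr -big_split /=.
  by apply: eq_bigr => k _; exact: complexE.
by apply: cvgD; [|apply: cvgMr]; exact: cvg_toC.
Qed.

(** (n + 1)^d <= (2^d)^n, so the entries are dominated by the exponential series
    at 2^d c. *)
Lemma growth_exp_cvg_series (c : R) X : 0 <= c ->
  growth (fun n => c ^+ n / n`!%:R) X -> cvgn (series X).
Proof.
move=> c0 [K [d h]].
have hij i j : cvgn (series (fun n => X n i j)).
  apply: (@cvg_series_dominated _ (fun n => K%:R * exp_coeff (2 ^+ d * c) n)); last first.
    have -> : series (fun n => K%:R * exp_coeff (2 ^+ d * c) n) =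
        (fun n => K%:R * series (exp_coeff (2 ^+ d * c)) n).
      by apply/funext => n; rewrite /series /= mulr_sumr.
    by apply: is_cvgMr; exact: is_cvg_series_exp_coeff.
  move=> n; apply: le_trans (h n i j) _; rewrite toC_le /exp_coeff /=.
  rewrite exprMn -mulrA natrM -!mulrA ler_wpM2l //.
  rewrite !mulrA ler_wpM2r ?invr_ge0 // ler_wpM2r ?exprn_ge0 //.
  rewrite -exprM -natrX ler_nat mulnC expnM leq_wexp2r //.
  exact: ltn_expl.
apply/cvg_ex; exists (\matrix_(i, j) limn (series (fun n => X n i j))).
apply/cvg_mxP => i j; rewrite mxE.
under eq_cvg do rewrite /series /= summxE.
exact: hij.
Qed.

Lemma growth_exp_cvg0 (c : R) X : 0 <= c ->
  growth (fun n => c ^+ n / n`!%:R) X -> X n @[n --> \oo] --> (0 : M).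
Proof.
by move=> c0 hX; apply: cvg_series_cvg_0; exact: growth_exp_cvg_series hX.
Qed.

End MatrixLimits.

(** Stated with the norm of the limit, which is real without further argument. *)
Lemma cvg_norm_ge (R : realType) (v : nat -> Cplx R) (l : Cplx R) (d : R) :
  0 <= d -> (forall n, (0 < n)%N -> toC d <= v n) ->
  v n @[n --> \oo] --> l -> toC d <= `|l|.
Proof.
move=> d0 dv vl; rewrite real_leNgt ?realE ?normr_ge0 ?toC_ge0 ?d0 //.
apply/negP => ld; rewrite -subr_gt0 in ld.
move/cvgrPdist_lt : vl => /(_ _ ld) /(filterI (nbhs_infty_gt 0)).
move=> /filter_ex [n [n0 vn]].
have : `|v n| < toC d.
  rewrite -(subrK l (v n)) (le_lt_trans (ler_normD _ _)) // -ltrBrDr distrC.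
  exact: vn.
have vd := dv n n0.
rewrite ger0_norm ?(le_trans _ vd) ?toC_ge0 // => /(le_lt_trans vd).
by rewrite ltxx.
Qed.

(** * Adjoints, triangular and diagonal matrices *)

Section Adjoint.
Variables (R : realType) (m : nat).
Local Notation C := (Cplx R).
Local Notation M := 'M[C]_m.+1.
Implicit Types X Y : M.

Lemma trmxCM X Y : (X * Y)^t* = Y^t* * X^t*.
Proof. by rewrite trmx_mul map_mxM. Qed.
Lemma trmxCD X Y : (X + Y)^t* = X^t* + Y^t*.
Proof. by rewrite linearD /= map_mxD. Qed.
Lemma trmxC1 : (1 : M)^t* = 1.
Proof. by rewrite trmx1 map_mx1. Qed.
Lemma trmxCX X n : (X ^+ n)^t* = X^t* ^+ n.
Proof. by elim: n => [|n IH]; rewrite ?expr0 ?trmxC1 // exprS trmxCM IH -exprSr. Qed.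
Lemma trmxCZ c X : (c *: X)^t* = c^* *: X^t*.
Proof. by apply/matrixP => i j; rewrite !mxE rmorphM. Qed.
Lemma trmxCB X Y : (X - Y)^t* = X^t* - Y^t*.
Proof. by apply/matrixP => i j; rewrite !mxE rmorphB. Qed.
Lemma trmxCV X : X \is a GRing.unit -> (X^-1)^t* = (X^t*)^-1.
Proof.
move=> uX; have h1 : X^t* * (X^-1)^t* = 1 by rewrite -trmxCM mulVr // trmxC1.
have h2 : (X^-1)^t* * X^t* = 1 by rewrite -trmxCM mulrV // trmxC1.
have uXt : X^t* \is a GRing.unit by apply/unitrP; exists ((X^-1)^t* : M).
by apply: (mulrI uXt); rewrite h1 mulrV.
Qed.
Lemma trmxC_unit X : X \is a GRing.unit -> X^t* \is a GRing.unit.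
Proof.
move=> uX; apply/unitrP; exists ((X^-1)^t* : M).
by rewrite -!trmxCM mulVr // mulrV // trmxC1.
Qed.

Lemma strict_trig_nilp X : (forall i j : 'I_m.+1, (i <= j)%N -> X i j = 0) ->
  X ^+ m.+1 = 0.
Proof.
move=> hX.
have hk k (i j : 'I_m.+1) : (i < j + k)%N -> (X ^+ k) i j = 0.
  elim: k i j => [|k IH] i j ij.
    by rewrite expr0 mxE -(inj_eq val_inj) /= ltn_eqF // -(addn0 j).
  rewrite exprS mxE big1 // => l _.
  have [il|li] := leqP i l; first by rewrite hX ?mul0r.
  by rewrite IH ?mulr0 // -ltnS -addnS (leq_trans _ ij).
apply/matrixP => i j; rewrite hk ?mxE //.
by rewrite (leq_trans (ltn_ord i)) // leq_addl.
Qed.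

End Adjoint.

Section DiagonalMatrices.
Variables (R : realType) (m : nat).
Local Notation C := (Cplx R).
Local Notation M := 'M[C]_m.+1.

Lemma posdefmx_diag_gt0 (D : M) i : posdefmx D -> 0 < D i i.
Proof.
move=> [_ /(_ (delta_mx i 0))].
have v0 : (delta_mx i 0 : 'cV[C]_m.+1) != 0.
  by apply/negP => /eqP/matrixP/(_ i 0); rewrite !mxE !eqxx; apply/eqP/oner_neq0.
move=> /(_ v0); set v := delta_mx i 0.
suff -> : (v^t* *m D *m v) ord0 ord0 = D i i by [].
have -> : v^t* = delta_mx 0 i.
  by apply/matrixP => k l; rewrite !mxE andbC rmorph_nat.
by rewrite -rowE -colE !mxE.
Qed.

Lemma diag_inv (D : M) (d : 'I_m.+1 -> C) :
  D = diag_mx (\row_j d j) -> (forall j, d j != 0) ->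
  D \is a GRing.unit /\ D^-1 = diag_mx (\row_j (d j)^-1).
Proof.
move=> DE d0; set V := diag_mx _.
have DV : D * V = 1.
  rewrite DE -mulmxE mulmx_diag; apply/matrixP => i j; rewrite !mxE.
  by rewrite mulfV.
have uD : D \is a GRing.unit.
  suff: D \in unitmx by [].
  by have := mulmx1_unit DV; case.
by split=> //; apply: (mulrI uD); rewrite mulrV // DV.
Qed.

Lemma is_diag_mxE (D : M) : is_diag_mx D -> D = diag_mx (\row_j D j j).
Proof.
move=> /is_diag_mxP hD; apply/matrixP => i j; rewrite !mxE.
by case: eqP => [->|/eqP ij]; rewrite ?mulr1n // mulr0n hD // neq_ltn.
Qed.

End DiagonalMatrices.

Lemma mx_inv_uniq (F : fieldType) (m : nat) (X Y : 'M[F]_m.+1) :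
  X * Y = 1 -> X^-1 = Y.
Proof.
move=> XY; have uX : X \is a GRing.unit.
  suff: X \in unitmx by []; by case: (mulmx1_unit XY).
by apply: (mulrI uX); rewrite mulrV // XY.
Qed.

Lemma conj_scaled_inv (F : fieldType) (m : nat) (k : F) (l w x v : 'M[F]_m.+1) :
  k != 0 -> l \is a GRing.unit -> w \is a GRing.unit -> x \is a GRing.unit ->
  v \is a GRing.unit ->
  (k *: (l^-1 * w * (x * (v^-1 * l))))^-1
    = k^-1 *: (l^-1 * v * (x^-1 * (w^-1 * l))).
Proof.
move=> k0 ul uw ux uv; apply: mx_inv_uniq.
rewrite scal_l scal_r scalerA mulfV // scale1r !mulrA.
by rewrite (mulrK ul) (mulrVK uv) (mulrK ux) (mulrK uw) mulVr.
Qed.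

Lemma scaled_swap (F : fieldType) (m : nat) (c k : F) (x w z y e : 'M[F]_m.+1) :
  y * x = k *: (e * y) ->
  y * (c *: (x * w)) * z = (c * k) *: (e * (y * w * z)).
Proof. by move=> yx; rewrite scal_r scal_l (mulrA y) yx !scal_l scalerA !mulrA. Qed.

Lemma leq_fact p q : (p <= q -> p`! <= q`!)%N.
Proof.
move=> /subnK <-; elim: (q - p)%N => // k IH.
by rewrite addSn factS (leq_trans IH) // leq_pmull.
Qed.

Lemma fact_add_le p s : ((p + s)`! <= s`! * (p + s) ^ p)%N.
Proof.
suff h q : (q <= p -> (q + s)`! <= s`! * (p + s) ^ q)%N by exact: h.
elim: q => [|q IH] qp; first by rewrite add0n expn0 muln1.
rewrite addSn factS expnS mulnCA leq_mul ?IH ?(ltnW qp) //.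
by rewrite -addSn leq_add2r.
Qed.

(** * The matrices of the Charlier weight *)

Section Charlier.
Variables (R : realType) (m : nat) (a : R) (mu : 'I_m.+1 -> R).
Hypotheses (ha : 0 < a) (hmu : mu_spec a mu).
Local Notation N := m.+1.
Local Notation C := (Cplx R).
Local Notation M := 'M[C]_N.
Local Notation A := (Amx mu).
Local Notation J := (Jmx R m).
Local Notation K := (Jmx R m * (Amx mu)^t*).
Local Notation u := (1 + Amx mu).
Local Notation L := (L0 a mu).
Local Notation ac := (toC a : C).
Local Notation T lam := (Tmx m a lam).
Local Notation W lam := (weight a mu lam).
Local Notation cA s := (calA m a s).
Implicit Types (i j : 'I_N).

Lemma ac_neq0 : ac != 0.
Proof. by rewrite toC_eq0 gt_eqF. Qed.

Lemma JmxMl (X : M) i j : (J * X) i j = (i.+1)%:R * X i j.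
Proof. by rewrite -mulmxE mul_diag_mx !mxE. Qed.

Lemma JmxMr (X : M) i j : (X * J) i j = X i j * (j.+1)%:R.
Proof. by rewrite -mulmxE mul_mx_diag !mxE. Qed.

Lemma JmxE i j : J i j = (i == j)%:R * i.+1%:R.
Proof. by rewrite !mxE; case: eqP => _; rewrite ?mul1r ?mul0r. Qed.

Lemma mx1E i j : (1 : M) i j = (i == j)%:R.
Proof. by rewrite mxE. Qed.

Lemma mu_gt0 j : 0 < mu j. Proof. by case: hmu. Qed.
Lemma mu_neq0 j : mu j != 0. Proof. by rewrite gt_eqF ?mu_gt0. Qed.

Lemma mu_ratio_sqr i j : i = j.+1 :> nat ->
  (mu i / mu j) ^+ 2 = (N - i)%:R / a.
Proof.
move=> ij; case: hmu => _ ->; rewrite ij.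
have -> : (j%:Z - j.+1%:Z = -1)%R by rewrite -[j.+1]addn1 PoszD; ring.
have jN : (j.+1 < N)%N by rewrite -ij.
rewrite exprN1 -(subnSK jN) factS natrM mulfK ?pnatr_eq0 -?lt0n ?fact_gt0 //.
by rewrite mulrC subnSK.
Qed.

Lemma AmxS i j : i = j.+1 :> nat -> A i j = toC (mu i / mu j).
Proof. by move=> ij; rewrite mxE ij eqxx. Qed.

Lemma Amx_nS i j : i <> j.+1 :> nat -> A i j = 0.
Proof. by move=> /eqP ij; rewrite mxE (negPf ij). Qed.

Lemma Amx_conj i j : (A i j)^* = A i j.
Proof. by rewrite mxE; case: ifP => _; rewrite ?toC_conj ?rmorph0. Qed.

Lemma adjAE i j : A^t* i j = A j i.
Proof. by rewrite [LHS]mxE mxE Amx_conj. Qed.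

Lemma comm_JA : J * A = A * J + A.
Proof.
apply/matrixP => i j; rewrite entD JmxMl JmxMr.
have [ij|ij] := eqVneq (i : nat) j.+1; first by rewrite ij -natr1; ring.
by rewrite (Amx_nS (elimN eqP ij)) !(mulr0, mul0r) addr0.
Qed.

(** The commutator of A and K, an affine function of J: the Cartan element. *)
Definition hmx : M := ac^-1 *: (2 *: J - (N.+1)%:R%:A).

(** Both A K and K A are diagonal, with entries i (N - i) / a and
    (i + 1) (N - i - 1) / a in row i (counted from 0). *)
Lemma comm_AK : A * K = K * A + hmx.
Proof.
have hAK i j : (A * K) i j = (i == j)%:R * (i%:R * (N - i)%:R / ac).
  rewrite mulrA [LHS]mxE.
  have [ij|ij] := eqVneq i j; last first.
    rewrite mul0r big1 // => k _; rewrite adjAE JmxMr.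
    have [ik|ik] := eqVneq (i : nat) k.+1; last first.
      by rewrite (Amx_nS (elimN eqP ik)) !mul0r.
    have [jk|jk] := eqVneq (j : nat) k.+1; last first.
      by rewrite (Amx_nS (elimN eqP jk)) mulr0.
    by rewrite -(inj_eq val_inj) /= ik jk eqxx in ij.
  rewrite -{j}ij mul1r; case: i => -[|i] hi.
    by rewrite big1 ?mul0r ?mul0r // => k _; rewrite adjAE Amx_nS // mulr0.
  rewrite (bigD1 (Ordinal (ltnW hi))) //= big1 => [|k ki]; last first.
    rewrite adjAE Amx_nS ?mulr0 //= => -[ik].
    by rewrite -(inj_eq val_inj) /= ik eqxx in ki.
  rewrite addr0 adjAE JmxMr AmxS //= mulrAC -expr2 -toCX mu_ratio_sqr //=.
  by rewrite toCM toCV toC_nat; ring.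
have hKA i j : (K * A) i j = (i == j)%:R * (i.+1%:R * (N - i.+1)%:R / ac).
  rewrite -mulrA JmxMl [X in _ * X]mxE.
  have [ij|ij] := eqVneq i j; last first.
    rewrite mul0r big1 ?mulr0 // => k _; rewrite adjAE.
    have [ik|ik] := eqVneq (k : nat) i.+1; last first.
      by rewrite (Amx_nS (elimN eqP ik)) !mul0r.
    have [jk|jk] := eqVneq (k : nat) j.+1; last first.
      by rewrite (Amx_nS (elimN eqP jk)) mulr0.
    by rewrite -(inj_eq val_inj) /= -eqSS -ik -jk eqxx in ij.
  rewrite -{j}ij mul1r.
  have [iN|iN] := ltnP i.+1 N; last first.
    rewrite big1; first by rewrite (eqnP iN) mulr0 !(mulr0, mul0r).
    move=> k _; rewrite adjAE Amx_nS ?mul0r // => ki.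
    by have := ltn_ord k; rewrite ki ltnNge iN.
  rewrite (bigD1 (Ordinal iN)) //= big1 => [|k ki]; last first.
    rewrite adjAE Amx_nS ?mul0r //= => ik.
    by rewrite -(inj_eq val_inj) /= ik eqxx in ki.
  rewrite addr0 adjAE AmxS //= -expr2 -toCX mu_ratio_sqr //=.
  by rewrite toCM toCV toC_nat; ring.
apply/matrixP => i j; rewrite /hmx !entE hAK hKA JmxE mx1E.
have [ij|ij] := eqVneq i j; last by rewrite /=; ring.
rewrite (natrB _ (ltn_ord i)) (natrB _ (ltnW (ltn_ord i))) -!natr1.
by field; exact: ac_neq0.
Qed.

Lemma TmxMl lam (X : M) i j :
  (Tmx m a lam * X) i j = toC (delta a lam i) * X i j.
Proof. by rewrite -mulmxE mul_diag_mx !mxE. Qed.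

Lemma TmxMr lam (X : M) i j :
  (X * Tmx m a lam) i j = X i j * toC (delta a lam j).
Proof. by rewrite -mulmxE mul_mx_diag !mxE. Qed.

Lemma deltaS lam j : toC (delta a lam.+1 j) =
  ac / 2 * ((lam%:R + j.+1%:R) * toC (delta a lam j)).
Proof.
rewrite /delta exprS addSn factS -addnS natrM natrD.
by rewrite !(toCM, toCD, toCV, toC_nat); ring.
Qed.

Lemma delta_shift lam i j : j = i.+1 :> nat ->
  toC (delta a lam.+1 i) = ac / 2 * (i.+1%:R * toC (delta a lam j)).
Proof.
move=> ij; rewrite /delta exprS ij addSnnS factS natrM !(toCM, toCV, toC_nat).
by field; rewrite ?nat1r ?natr1 !pnatr_eq0 -?lt0n ?fact_gt0.
Qed.

Lemma Tmx_succ lam :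
  Tmx m a lam.+1 = (ac / 2) *: ((lam%:R%:A + J) * Tmx m a lam).
Proof.
apply/matrixP => i j; rewrite mulrDl mulr_algl !entE JmxMl.
rewrite -[Tmx m a lam.+1]mulr1 -[Tmx m a lam]mulr1 !TmxMl deltaS !mx1E; ring.
Qed.

Lemma Tmx_succ_adjA lam :
  Tmx m a lam.+1 * A^t* = (ac / 2) *: (K * Tmx m a lam).
Proof.
apply/matrixP => i j; rewrite entZ TmxMl TmxMr JmxMl adjAE.
have [ij|ij] := eqVneq (j : nat) i.+1; first by rewrite (delta_shift lam ij); ring.
by rewrite (Amx_nS (elimN eqP ij)) !(mulr0, mul0r).
Qed.

Lemma AmxX k i j : (A ^+ k) i j =
  if i == (j + k)%N :> nat then toC (mu i / mu j) else 0.
Proof.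
elim: k i j => [|k IH] i j.
  rewrite expr0 mx1E addn0 -(inj_eq val_inj) /=.
  by case: eqP => // /val_inj ->; rewrite divff ?mu_neq0 ?toC1.
rewrite exprS mxE addnS.
have [ij|ij] := eqVneq (i : nat) (j + k).+1; last first.
  rewrite big1 // => l _; rewrite IH.
  have [il|il] := eqVneq (i : nat) l.+1; last first.
    by rewrite (Amx_nS (elimN eqP il)) mul0r.
  by case: eqP => [lj|]; rewrite ?mulr0 //; rewrite il lj eqxx in ij.
have jkN : (j + k < N)%N by rewrite -ltnS -ij; exact: ltnW (ltn_ord i).
rewrite (bigD1 (Ordinal jkN)) //= big1 => [|l]; last first.
  rewrite IH -(inj_eq val_inj) /= => /negPf ->; exact: mulr0.
rewrite addr0 IH AmxS //= eqxx -toCM mulrA mulfVK //.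
exact: mu_neq0.
Qed.

Lemma Amx_nilp : A ^+ N = 0.
Proof.
apply/matrixP => i j; rewrite AmxX mxE; case: eqP => // ij.
by have := ltn_ord i; rewrite ij ltnNge leq_addl.
Qed.

Lemma u_unit : u \is a GRing.unit. Proof. exact: unip_unit Amx_nilp. Qed.

(** L0 is exp(- a A): the powers of A are the subdiagonals with the ratios of the
    mu_j as entries. *)
Lemma L0E : L = \sum_(k < N.+1) toC ((- a) ^+ k / k`!%:R) *: A ^+ k.
Proof.
rewrite big_ord_recr /= Amx_nilp scaler0 addr0.
apply/matrixP => i j; rewrite summxE mxE; case: leqP => ij; last first.
  rewrite big1 // => k _; rewrite entZ AmxX; case: eqP => [h|]; last by rewrite mulr0.
  by rewrite h ltnNge leq_addr in ij.
have ijN : (i - j < N)%N by exact: leq_ltn_trans (leq_subr _ _) (ltn_ord i).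
rewrite (bigD1 (Ordinal ijN)) //= big1 => [|k]; last first.
  rewrite entZ AmxX -(inj_eq val_inj) /=.
  case: (i =P (j + k)%N :> nat) => [->|_ _]; last exact: mulr0.
  by rewrite addKn eqxx.
by rewrite addr0 entZ AmxX subnKC // eqxx -toCM mulrC.
Qed.

Lemma L0_diag j : L j j = 1.
Proof.
by rewrite mxE leqnn subnn expr0 fact0 divr1 mulr1 divff ?mu_neq0.
Qed.

Lemma L0_unit : L \is a GRing.unit.
Proof.
suff: L \in unitmx by [].
rewrite unitmxE det_trig; last first.
  by apply/is_trig_mxP => i j ij; rewrite mxE leqNgt ij.
rewrite unitfE; apply/prodf_neq0 => i _.
by rewrite L0_diag oner_neq0.
Qed.

Lemma comm_AL0 : A * L = L * A.
Proof.
rewrite L0E mulr_sumr mulr_suml; apply: eq_bigr => k _.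
by rewrite -scalerAr -scalerAl -exprS exprSr.
Qed.

Definition Bmx : M := A * u^-1.

Lemma Bmx_u : Bmx * u = A.
Proof. by rewrite /Bmx mulrVK ?u_unit. Qed.

Lemma u_Bmx : u * Bmx = A.
Proof.
rewrite /Bmx mulrA; apply: (mulIr u_unit); rewrite mulrVK ?u_unit //.
by rewrite mulrDl mulrDr mul1r mulr1.
Qed.

Lemma exp_coef_succ k :
  k.+1%:R * toC ((- a) ^+ k.+1 / k.+1`!%:R) = - ac * toC ((- a) ^+ k / k`!%:R).
Proof.
rewrite factS natrM exprS -toC_nat -toCN -!toCM; congr toC.
by field; rewrite ?nat1r ?natr1 !pnatr_eq0 -?lt0n ?fact_gt0.
Qed.

Definition Smx t : M := (N + t)%:R%:A - J.

Lemma L0_conj t : L * (t%:R%:A + J + K) = (Smx t.+1 + K) * L.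
Proof.
rewrite (exp_conj ac_neq0 (erefl hmx) comm_JA comm_AK Amx_nilp
   exp_coef_succ L0E).
by rewrite /Smx addnS -addSn natrD.
Qed.

Lemma L0_shift t s :
  L * (Smx t + ac *: A + s%:R *: Bmx) = (Smx t + s%:R *: Bmx) * L.
Proof.
exact: (exp_shift comm_JA (erefl u) Bmx_u Amx_nilp
   exp_coef_succ L0E _ _ u_unit).
Qed.

Lemma upow_Smx t s : u ^+ s * Smx t = (Smx t + s%:R *: Bmx) * u ^+ s.
Proof. exact: (upow_shift comm_JA (erefl u) Bmx_u u_Bmx). Qed.

Lemma SmxE t : Smx t = diag_mx (\row_j (m - j + t)%:R).
Proof.
apply/matrixP => i j; rewrite entD entN entZ mx1E JmxE !mxE.
case: (i =P j) => [_|_]; last by rewrite mulr0n mulr0 mul0r subr0.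
have im : (i <= m)%N by rewrite -ltnS.
rewrite mulr1n mul1r mulr1 -natrB; first by rewrite addSn subSS addnBAC.
exact: leq_trans (ltn_ord i) (leq_addr _ _).
Qed.

Lemma SmxMl t (X : M) i j : (Smx t * X) i j = (m - i + t)%:R * X i j.
Proof. by rewrite SmxE -mulmxE mul_diag_mx !mxE. Qed.

(** The recursion trades n for lam, as that of the Rodrigues polynomials does, so
    that n + lam stays constant along it. *)
Fixpoint Emx n lam : M :=
  if n is n'.+1 then Emx n' lam.+1 * Smx lam.+1 else 1.

Lemma EmxE n lam :
  Emx n lam = diag_mx (\row_j (((m - j + (lam + n))`!)%:R / ((m - j + lam)`!)%:R)).
Proof.
elim: n lam => [|n IH] lam.
  apply/matrixP => i j; rewrite /= mx1E !mxE addn0 divff ?pnatr_eq0 -?lt0n ?fact_gt0 //.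
rewrite /= IH SmxE -mulmxE mulmx_diag; congr diag_mx; apply/rowP => j; rewrite !mxE.
rewrite addSnnS !addnS [X in _ / X%:R * _]factS natrM invfM.
by rewrite mulrA mulrAC mulfVK.
Qed.

Lemma Emx_unit n lam : Emx n lam \is a GRing.unit.
Proof.
suff: Emx n lam \in unitmx by [].
rewrite EmxE unitmxE det_diag unitfE; apply/prodf_neq0 => i _.
by rewrite mxE mulf_neq0 ?invr_eq0 // pnatr_eq0 -lt0n fact_gt0.
Qed.

Lemma adjA_sqrt i j : A^t* i j =
  if j == i.+1 :> nat then toC (Num.sqrt ((N - i.+1)%:R / a)) else 0.
Proof.
rewrite adjAE; case: eqP => [ji|ji]; last exact: Amx_nS.
rewrite (AmxS ji); congr toC.
have h0 : 0 <= mu j / mu i by rewrite divr_ge0 // ltW // mu_gt0.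
by rewrite -{1}ji -(mu_ratio_sqr ji) sqrtr_sqr ger0_norm.
Qed.

(** At s = 0 the last diagonal entry of Smx s vanishes. *)
Lemma Smx_calA s : (0 < s)%N -> Smx s * cA s = K.
Proof.
move=> s0; apply/matrixP => i j; rewrite SmxMl JmxMl adjA_sqrt mxE.
case: ifP => _; last by rewrite !mulr0.
have im : (i <= m)%N by rewrite -ltnS.
rewrite addSn subSS -addnBAC // !toCM toCV !toC_nat mulrA; congr (_ * _).
by rewrite mulrC divfK // pnatr_eq0 -lt0n addn_gt0 s0 orbT.
Qed.

Lemma calA_J s : cA s * J = J * cA s + cA s.
Proof.
apply/matrixP => i j; rewrite entD JmxMl JmxMr mxE.
case: eqP => [->|_]; last by rewrite mulr0 mul0r addr0.
by rewrite -[i.+2%:R]natr1 mulrDr mulr1 mulrC.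
Qed.

Fixpoint raise_prod n lam : M :=
  if n is n'.+1 then raise_prod n' lam.+1 * (lam%:R%:A + J + K) else 1.

(** Conjugation by L0 turns the factors into Smx t + K, and K = Smx s calA_s with
    the same s = n + lam at every step, which is what [unip_factor] needs to
    move the successive Smx t to the left. *)
Lemma L0_raise_prod n lam :
  L * raise_prod n lam = Emx n lam * (1 + cA (n + lam)) ^+ n * L.
Proof.
elim: n lam => [|n IH] lam; first by rewrite /= expr0 !mulr1 mul1r.
rewrite /= mulrA IH -!mulrA; congr (_ * _); rewrite L0_conj !mulrA; congr (_ * _).
rewrite addSnnS.
have := unip_factor (erefl (Smx (n + lam.+1))) (esym (Smx_calA _)) (calA_J _) n.
have -> : Smx (n + lam.+1) - n%:R%:A = Smx lam.+1.
  by rewrite /Smx addnCA natrD scalerDl addrAC [n%:R%:A + _]addrC addrK.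
by apply; rewrite addnS.
Qed.

Lemma upow_unit k : u ^+ k \is a GRing.unit.
Proof. by rewrite unitrX // u_unit. Qed.

Lemma upow_L0 k : u ^+ k * L = L * u ^+ k.
Proof.
have uL : GRing.comm L u by rewrite /GRing.comm mulrDl mulrDr mul1r mulr1 comm_AL0.
exact: commr_sym (commrX k uL).
Qed.

Lemma upowN_L0 k : u ^- k * L = L * u ^- k.
Proof.
apply: (mulrI (upow_unit k)); rewrite !mulrA mulrV ?upow_unit // mul1r upow_L0.
by rewrite mulrK // upow_unit.
Qed.

Local Notation B := Bmx.
Local Notation h := hmx.
Local Notation S := Smx.
Local Notation E := Emx.

Lemma two_neq0 : (2 : C) != 0. Proof. by rewrite pnatr_eq0. Qed.

(** * The Rodrigues polynomials *)

(** The polynomials W_(lam+1)(x) W_lam(x)^-1 and W_(lam+1)(x - 1) W_lam(x)^-1 of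
    [weight_stay] and [weight_back].  The second vanishes at x = 0. *)
Definition stay_poly lam : {poly M} :=
  ((ac / 2) *: (u * (lam%:R%:A + J + K) - lam%:R *: A + lam%:R *: h
     - (lam%:R * (lam%:R + 1) / ac) *: B))%:P
  + ((ac / 2) *: (h - A - ((2 * lam%:R + 1) / ac) *: B))%:P * 'X
  + (- (2^-1 *: B))%:P * 'X^2.

Definition back_poly lam : {poly M} :=
  (2^-1 *: (lam%:R%:A + J - lam%:R *: B))%:P * 'X + (- (2^-1 *: B))%:P * 'X^2.

Lemma horner_stay_poly lam x : (stay_poly lam).[x%:R] =
  (ac / 2) *: (u * (lam%:R%:A + J + K) - (x + lam)%:R *: A + (x + lam)%:R *: h
     - ((x + lam)%:R * ((x + lam)%:R + 1) / ac) *: B).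
Proof.
rewrite /stay_poly horner_quad.
rewrite [(x + lam)%N]addnC natrD.
exact: (raising_poly A ac_neq0 h B two_neq0 _ x%:R lam%:R).
Qed.

Lemma horner_back_poly lam x : (back_poly lam).[x%:R] =
  (x%:R / 2) *: (lam%:R%:A + J - (x + lam)%:R *: B).
Proof.
rewrite /back_poly -[X in X + _]add0r -polyC0 horner_quad add0r.
rewrite [(x + lam)%N]addnC natrD.
exact: (lowering_poly B _ x%:R lam%:R).
Qed.

Lemma weight_stay lam x : W lam.+1 x = (stay_poly lam).[x%:R] * W lam x.
Proof.
rewrite /weight scal_r horner_stay_poly; congr (_ *: _).
rewrite scal_l !mulrA -(upow_conj ac_neq0 (erefl h) comm_JA
   comm_AK (erefl u) Bmx_u u_Bmx).
rewrite addnS [(1 + A^t*) ^+ _.+1]exprS !mulrA -[_ * T lam.+1 * _]mulrA.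
have -> : T lam.+1 * (1 + A^t*) = (ac / 2) *: ((lam%:R%:A + J + K) * T lam).
  by rewrite mulrDr mulr1 Tmx_succ_adjA Tmx_succ -scalerDr -mulrDl.
by rewrite scal_r scal_l mulrA.
Qed.

Lemma weight_back lam x : W lam.+1 x = (back_poly lam).[x.+1%:R] * W lam x.+1.
Proof.
rewrite /weight addnS addSn horner_back_poly !scal_l !scal_r Tmx_succ.
rewrite scal_r !scal_l !mulrA (upow_shiftD comm_JA (erefl u) Bmx_u u_Bmx).
rewrite !scalerA addSn; congr (_ *: _).
rewrite factS natrM exprS !(toCM, toCV, toC_nat) invfM.
by field; rewrite ?nat1r ?natr1 !pnatr_eq0 -?lt0n ?fact_gt0.
Qed.

(** R_n such that R_n W_lam is the n-th backward difference of W_(lam+n): the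
    outermost difference is taken of R_(n-1) W_(lam+1), itself an (n-1)-st
    difference. *)
Fixpoint rodrigues n lam : {poly M} :=
  if n is n'.+1 then rodrigues n' lam.+1 * stay_poly lam
    - (rodrigues n' lam.+1 \Po ('X + (-1)%:P)) * back_poly lam
  else 1.

Lemma horner_rodriguesS n lam x : (rodrigues n.+1 lam).[x.+1%:R] * W lam x.+1 =
  (rodrigues n lam.+1).[x.+1%:R] * W lam.+1 x.+1
  - (rodrigues n lam.+1).[x%:R] * W lam.+1 x.
Proof.
rewrite /= hornerD hornerN !horner_natM mulrBl -!mulrA -weight_stay -weight_back.
rewrite horner_shift; last by apply: commr_nat.
by rewrite -natr1 addrK.
Qed.

Lemma horner_rodrigues0 n lam : (rodrigues n.+1 lam).[0] =
  (rodrigues n lam.+1).[0] * (stay_poly lam).[0].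
Proof.
rewrite /= hornerD hornerN -[0]/(0%:R) !horner_natM.
by rewrite horner_back_poly mul0r scale0r mulr0 subr0.
Qed.

Local Notation rod := rodrigues.

(** The factor is - Gmx lam n, with the conjugations carried out by [L0_shift] and
    [upow_Smx]. *)
Fixpoint rod_lead n lam : M :=
  if n is n'.+1 then - (rod_lead n' lam.+1 *
     (2^-1 *: (S lam.+1 + ac *: A + (n + lam)%:R *: B)))
  else 1.

Local Notation lead := rod_lead.

Lemma rodrigues_lead n lam :
  (size (rod n lam) <= n.+1)%N /\ (rod n lam)`_n = rod_lead n lam.
Proof.
elim: n lam => [|n IH] lam; first by rewrite /= size_poly1 coef1.
have [sz lead] := IH lam.+1; rewrite /= -lead.
have [sz' ->] := rodrigues_step
  ((ac / 2) *: (u * (lam%:R%:A + J + K) - lam%:R *: A + lam%:R *: h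
     - (lam%:R * (lam%:R + 1) / ac) *: B))
  ((ac / 2) *: (h - A - ((2 * lam%:R + 1) / ac) *: B))
  (- (2^-1 *: B)) (2^-1 *: (lam%:R%:A + J - lam%:R *: B)) sz.
split=> //; rewrite -mulrnAr -mulrDr -mulrN; congr (_ * _).
have e : (n.+1 + lam)%:R = lam%:R + n%:R + 1 :> C.
  by rewrite addSn -natr1 natrD [lam%:R + _]addrC.
rewrite mulNrn -[(2^-1 *: B) *+ n]scaler_nat e /Smx addnS -addSn natrD.
exact: (leading_coef_eq A ac_neq0 (erefl h) B two_neq0 lam%:R n%:R).
Qed.

(** In the basis given by u^-(n+lam) L0 all the factors of the leading coefficient
    become the diagonal matrices Smx t, because n + lam is the same for all of
    them. *)
Lemma rod_leadE n lam : u ^- (n + lam) * L * rod_lead n lam =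
  (- 2^-1) ^+ n *: (E n lam * u ^- (n + lam) * L).
Proof.
elim: n lam => [|n IH] lam; first by rewrite /= expr0 scale1r mul1r mulr1.
rewrite /= mulrN mulrA addSnnS IH scal_l !scal_r -!mulrA L0_shift.
have -> : u ^- (n + lam.+1) * ((S lam.+1 + (n + lam.+1)%:R *: B) * L) =
    S lam.+1 * (u ^- (n + lam.+1) * L).
  rewrite !mulrA; congr (_ * _); apply: (mulIr (upow_unit (n + lam.+1))).
  by rewrite -mulrA -upow_Smx mulKr ?mulrVK ?upow_unit.
by rewrite -scaleNr scalerA exprS !mulNr [2^-1 * _]mulrC.
Qed.

Lemma rod_lead_unit n lam : rod_lead n lam \is a GRing.unit.
Proof.
have uY : u ^- (n + lam) * L \is a GRing.unit.
  by rewrite unitrMl ?L0_unit // unitrV unitrX // u_unit.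
rewrite -(unitrMr _ uY) rod_leadE.
have k0 : (- 2^-1 : C) ^+ n \is a GRing.unit.
  by rewrite unitrX // unitfE oppr_eq0 invr_eq0 two_neq0.
by rewrite scaler_unit // -mulrA unitrMl // Emx_unit.
Qed.

Lemma rod_lead_inv n lam : u ^- (n + lam) * L * (lead n lam)^-1 =
  (- 2) ^+ n *: ((E n lam)^-1 * (u ^- (n + lam) * L)).
Proof.
set Y := u ^- _ * L; apply: (mulIr (rod_lead_unit n lam)).
rewrite mulrVK ?rod_lead_unit // scal_l -mulrA rod_leadE -mulrA -/Y.
rewrite scal_r mulKr ?(Emx_unit n lam) // scalerA -exprMn.
by rewrite mulrNN mulfV ?two_neq0 // expr1n scale1r.
Qed.

Lemma rod_at0 n lam :
  (rod n lam).[0] * u ^+ lam = (ac / 2) ^+ n *: (u ^+ (n + lam) * raise_prod n lam).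
Proof.
elim: n lam => [|n IH] lam; first by rewrite /= hornerC expr0 scale1r mul1r mulr1.
rewrite horner_rodrigues0 -mulrA.
have -> : (stay_poly lam).[0] * u ^+ lam =
    (ac / 2) *: (u ^+ lam.+1 * (lam%:R%:A + J + K)).
  rewrite (upow_conj ac_neq0 (erefl h) comm_JA
   comm_AK (erefl u) Bmx_u u_Bmx).
  by rewrite -[0]/(0%:R) horner_stay_poly add0n scal_l.
by rewrite scal_r !mulrA IH scal_l scalerA -exprS -!mulrA addSnnS.
Qed.

(** The diagonal matrix Emx n lam occurs both in R_n(0) and in its leading
    coefficient, and cancels. *)
Lemma monic_rod_at0 n lam :
  u ^- (n + lam) * L * ((rod_lead n lam)^-1 * (rodrigues n lam).[0]) =
  (- ac) ^+ n *: ((1 + cA (n + lam)) ^+ n * u ^- lam * L).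
Proof.
have -> : (rodrigues n lam).[0] =
   (ac / 2) ^+ n *: (u ^+ (n + lam) * raise_prod n lam * u ^- lam).
  by rewrite -scal_l -rod_at0 mulrK // upow_unit.
have Yu : u ^- (n + lam) * L * u ^+ (n + lam) = L.
  by rewrite upowN_L0 mulrVK // upow_unit.
have := rod_lead_inv n lam; move: (u ^- (n + lam) * L) Yu => y Yu yr.
rewrite mulrA yr scal_l !scal_r scalerA -exprMn; congr (_ *: _).
  by congr (_ ^+ _); rewrite mulNr mulrCA mulfV ?two_neq0 // mulr1.
rewrite -(mulrA _ y) -(mulrA (u ^+ _)) (mulrA y) Yu (mulrA L) L0_raise_prod.
by rewrite -!mulrA (mulKr (Emx_unit n lam)) upowN_L0.
Qed.

(** * Orthogonality *)

Lemma growth_upow k : growth (fun=> 1) (fun n => u ^+ (n + k)).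
Proof.
have g : growth (fun=> 1) (fun n => u ^+ n).
  by apply: growth_unip_exp => [_|]; [exact: Amx_nilp|exact: growth_cst].
apply: eq_growth (growthM _ _ g (growth_cst (u ^+ k))) => // n; first exact: mulr1.
by rewrite exprD.
Qed.

Lemma growth_upowN k : growth (fun=> 1) (fun n => u ^- (n + k)).
Proof.
have g : growth (fun=> 1) (fun n => u ^- n).
  by apply: growth_unip_expN => [_|]; [exact: Amx_nilp|exact: growth_cst].
apply: eq_growth (growthM _ _ g (growth_cst (u ^- k))) => // n; first exact: mulr1.
by rewrite -!exprVn exprD.
Qed.

Lemma trmxC_u : 1 + A^t* = u^t*.
Proof. by rewrite trmxCD trmxC1. Qed.

Lemma growth_weight lam : growth (fun x => a ^+ x / x`!%:R) (W lam).
Proof.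
have gu := growth_upow lam.
have g := growthM _ _ (growthM _ _ gu (growth_cst (Tmx m a lam))) (growth_adj gu).
have {}g : growth (fun=> 1)
    (fun x => u ^+ (x + lam) * T lam * (1 + A^t*) ^+ (x + lam)).
  by apply: eq_growth (g _ _ _ _) => // n; rewrite ?mulr1 // trmxCX trmxC_u.
apply: eq_growth (growthZ _ (v := fun x => a ^+ x / x`!%:R) _ g) => // n.
  by rewrite mulr1.
by rewrite toC_norm ger0_norm ?exp_term_ge0 // ltW.
Qed.

Lemma growth_ip_term lam (P Q : {poly M}) : growth (fun x => a ^+ x / x`!%:R)
  (fun x => P.[x%:R] * W lam x * (Q.[x%:R])^t*).
Proof.
have e0 := exp_term_ge0 (ltW ha).
have g := growthM _ _ (growthM _ _ (growth_horner P) (growth_weight lam))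
  (growth_adj (growth_horner Q)).
by apply: eq_growth (g _ _ _ _) => // n; rewrite ?mulr1 ?mul1r.
Qed.

Lemma cvg_ip lam (P Q : {poly M}) :
  series (fun x => P.[x%:R] * W lam x * (Q.[x%:R])^t*) n @[n --> \oo]
    --> ip (W lam) P Q.
Proof. exact: growth_exp_cvg_series (ltW ha) (growth_ip_term lam P Q). Qed.

Lemma ip_eq lam (P Q : {poly M}) (l : M) :
  series (fun x => P.[x%:R] * W lam x * (Q.[x%:R])^t*) n @[n --> \oo] --> l ->
  ip (W lam) P Q = l.
Proof. by move=> h; apply/cvg_lim => //; exact: norm_hausdorff. Qed.

Lemma ipBl lam (P P' Q : {poly M}) (c : M) :
  ip (W lam) (P - c%:P * P') Q = ip (W lam) P Q - c * ip (W lam) P' Q.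
Proof.
apply: ip_eq.
have -> : series (fun x : nat => (P - c%:P * P').[x%:R] * W lam x * (Q.[x%:R])^t*)
  = (fun n => series (fun x => P.[x%:R] * W lam x * (Q.[x%:R])^t*) n
     - c * series (fun x => P'.[x%:R] * W lam x * (Q.[x%:R])^t*) n).
  apply/funext => n; rewrite /series /= mulr_sumr -sumrB; apply: eq_bigr => x _.
  by rewrite hornerD hornerN horner_natM hornerC !mulrBl !mulrA.
by apply: cvgB; [exact: cvg_ip|apply: cvg_mxMl; exact: cvg_ip].
Qed.

Definition total_weight lam : M := ip (W lam) 1 1.

(** Each summation by parts moves one backward difference off the weight and onto
    f as a forward difference; after n of them f is the constant n! f_n. *)
Lemma ip_rodrigues n lam (f : {poly M}) : (size f <= n.+1)%N ->
  ip (W lam) (rod n lam) f =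
    ((-1) ^+ n * n`!%:R) *: (total_weight (n + lam) * (f`_n)^t*).
Proof.
move=> sf; apply: ip_eq; elim: n lam f sf => [|n IH] lam f sf.
  rewrite expr0 mul1r scale1r.
  have -> : series (fun x : nat => (rod 0 lam).[x%:R] * W lam x * (f.[x%:R])^t*) =
    (fun n => series (fun x : nat => (1 : {poly M}).[x%:R] * W lam x
        * ((1 : {poly M}).[x%:R])^t*) n * (f`_0)^t*).
    apply/funext => n; rewrite /series /= mulr_suml; apply: eq_bigr => x _.
    by rewrite (size1_polyC sf) !hornerC trmxC1 mulr1 coefC.
  by apply: cvg_mxMr; exact: cvg_ip.
pose G x : M := (rod n lam.+1).[x%:R] * W lam.+1 x.
pose F x : M := (f.[x%:R])^t*.
pose f1 := (f \Po ('X + 1%:P)) - f.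
have f1E x : F x.+1 - F x = (f1.[x%:R])^t*.
  rewrite hornerD hornerN horner_shift; last exact: commr_sym (commr1 _).
  by rewrite natr1 trmxCB.
have -> : series (fun x : nat => (rod n.+1 lam).[x%:R] * W lam x * (f.[x%:R])^t*) =
   (fun k => (if k is k'.+1 then G k' else 0) * F k -
     series (fun x => (rod n lam.+1).[x%:R] * W lam.+1 x * (f1.[x%:R])^t*) k).
  apply/funext => k; rewrite /series /=.
  under [in RHS]eq_bigr do rewrite -f1E.
  rewrite -(sum_by_parts G F k); apply: eq_bigr => -[|x] _.
    rewrite subr0 /G /F weight_stay -[0%:R]/(0 : M) mulrA.
    by rewrite horner_rodrigues0.
  by rewrite -horner_rodriguesS.
have sf1 : (size f1 <= n.+1)%N by exact: size_shift_sub.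
have f1n : f1`_n = f`_n.+1 *+ n.+1 by rewrite (coef_shift_sub _ sf) mulr1.
have -> : ((-1) ^+ n.+1 * n.+1`!%:R) *: (total_weight (n.+1 + lam) * (f`_n.+1)^t*) =
   0 - ((-1) ^+ n * n`!%:R) *: (total_weight (n + lam.+1) * (f1`_n)^t*).
  rewrite f1n addSnnS -[f`_n.+1 *+ _]scaler_nat trmxCZ scal_r scalerA sub0r -scaleNr.
  by congr (_ *: _); rewrite rmorph_nat exprS factS natrM; ring.
apply: cvgB; last exact: IH.
rewrite -(cvg_shiftS _ (nbhs (0 : M))) /=.
have e0 := exp_term_ge0 (ltW ha).
apply: (@growth_exp_cvg0 _ _ a) (ltW ha) _.
have gF : growth (fun=> 1) (fun x => ((f \Po ('X + 1%:P)).[x%:R])^t*).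
  by apply: growth_adj; exact: growth_horner.
have g := growthM _ _ (growthM _ _ (growth_horner (rod n lam.+1))
   (growth_weight lam.+1)) gF.
apply: eq_growth (g _ _ _ _) => // x; rewrite ?mulr1 ?mul1r //.
rewrite /F horner_shift; last exact: commr_sym (commr1 _).
by rewrite natr1.
Qed.

Lemma delta_ge0 lam j : 0 <= delta a lam j.
Proof. by rewrite mulr_ge0 ?divr_ge0 // exprn_ge0 // divr_ge0 // ltW. Qed.

(** u commutes with L0, so the powers u^s of the weight disappear and the terms of
    the series become Gram matrices. *)
Lemma conj_weight s x : u ^- s * L * W s x * (u ^- s * L)^t* =
  toC (a ^+ x / x`!%:R) *: (L * u ^+ x * T s * (L * u ^+ x)^t*).
Proof.
have Yu : u ^- s * L * u ^+ (x + s) = L * u ^+ x.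
  by rewrite upowN_L0 addnC exprD -mulrA mulKr ?upow_unit.
rewrite /weight scal_r scal_l; congr (_ *: _).
by rewrite trmxC_u -trmxCX -Yu [in RHS]trmxCM !mulrA.
Qed.

Lemma gram_diag_ge (V : M) s j :
  toC (delta a s j) * `|V j j| ^+ 2 <= (V * T s * V^t*) j j.
Proof.
have -> : (V * T s * V^t*) j j = \sum_k toC (delta a s k) * `|V j k| ^+ 2.
  rewrite mxE; apply: eq_bigr => k _; rewrite TmxMr !mxE normCK; ring.
rewrite (bigD1 j) //= lerDl sumr_ge0 // => k _.
by rewrite mulr_ge0 ?toC_ge0 ?delta_ge0 // exprn_ge0.
Qed.

(** All terms of the series are positive semidefinite; the bound is the diagonal
    entry of the term at x = 0, the diagonal of L0 being 1. *)
Lemma total_weight_diag_ge s j : toC (delta a s j) <=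
  `|(u ^- s * L * total_weight s * (u ^- s * L)^t*) j j|.
Proof.
set Y := u ^- s * L.
have cW : Y * series (W s) n * Y^t* @[n --> \oo] --> Y * total_weight s * Y^t*.
  apply: cvg_mxMr; apply: cvg_mxMl.
  have -> : series (W s) =
     series (fun x => (1 : {poly M}).[x%:R] * W s x * ((1 : {poly M}).[x%:R])^t*).
    by congr series; apply/funext => x; rewrite hornerC trmxC1 mul1r mulr1.
  exact: cvg_ip.
have {}cW := (cvg_mxP _ _).1 cW j j.
apply: (cvg_norm_ge (delta_ge0 s j) _ cW) => -[//|n] _.
rewrite /series /= mulr_sumr mulr_suml summxE big_nat_recl //=.
have ge k : toC (delta a s j) * (toC (a ^+ k / k`!%:R) * `|(L * u ^+ k) j j| ^+ 2)
    <= (Y * W s k * Y^t*) j j.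
  rewrite conj_weight entZ mulrCA ler_wpM2l ?toC_ge0 ?exp_term_ge0 ?(ltW ha) //.
  exact: gram_diag_ge.
apply: le_trans (_ : _ <= (Y * W s 0 * Y^t*) j j) _.
  apply: le_trans (ge 0%N); rewrite expr0 fact0 divr1 toC1 mul1r expr0 mulr1.
  by rewrite L0_diag normr1 expr1n mulr1.
rewrite lerDl sumr_ge0 // => k _; apply: le_trans (ge _).
apply: mulr_ge0; first by rewrite toC_ge0 delta_ge0.
by apply: mulr_ge0 => //; rewrite toC_ge0 exp_term_ge0 // ltW.
Qed.

(** * Uniqueness and the dual weight *)

Section DualWeight.
Variables (lam : nat) (P : nat -> {poly M}) (D : nat -> M).
Hypotheses (hP : monic_orthogonal (W lam) P) (hD : sqnorm_diagonal a mu lam P D).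
Local Notation Y n := (u ^- (n + lam) * L).

Lemma Y_unit n : Y n \is a GRing.unit.
Proof. by rewrite unitrMl ?unitrV ?upow_unit // L0_unit. Qed.

Lemma D_unit n : D n \is a GRing.unit.
Proof.
have [dD pD _] := hD n.
have [] // := diag_inv (is_diag_mxE dD) => j.
by rewrite gt_eqF // posdefmx_diag_gt0.
Qed.

Lemma sqnormE n : sqnorm a mu lam P n = (Y n)^-1 * D n * ((Y n)^t*)^-1.
Proof.
have [_ _ ->] := hD n.
have uu := upow_unit (n + lam); have uL := L0_unit.
have uV : u ^- (n + lam) \is a GRing.unit by rewrite unitrV.
have -> : (Y n)^-1 = L^-1 * u ^+ (n + lam) by rewrite (invrM uV uL) invrK.
have -> : ((Y n)^t*)^-1 = (1 + A^t*) ^+ (n + lam) * (L^t*)^-1.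
  rewrite trmxC_u -trmxCX trmxCM (invrM (trmxC_unit uL) (trmxC_unit uV)).
  by rewrite (trmxCV uu) invrK.
by rewrite !mulrA.
Qed.

Lemma sqnorm_unit n : sqnorm a mu lam P n \is a GRing.unit.
Proof.
have uY := Y_unit n; have uD := D_unit n.
rewrite sqnormE unitrMl; last by rewrite unitrV (trmxC_unit uY).
by rewrite unitrMl // unitrV.
Qed.

Lemma sqnorm_inv n : (sqnorm a mu lam P n)^-1 = (Y n)^t* * (D n)^-1 * Y n.
Proof.
have uY := Y_unit n; have uD := D_unit n.
have uYV : (Y n)^-1 \is a GRing.unit by rewrite unitrV.
have uYt : (Y n)^t* \is a GRing.unit by exact: trmxC_unit.
have uYtV : ((Y n)^t*)^-1 \is a GRing.unit by rewrite unitrV.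
have uYD : (Y n)^-1 * D n \is a GRing.unit by rewrite unitrMl.
by rewrite sqnormE (invrM uYD uYtV) (invrM uYV uD) !invrK mulrA.
Qed.

(** Induction on n: subtracting the right multiple of P_n lowers the degree, and
    pairing with P_n then kills this multiple because the norm is
    invertible. *)
Lemma orth_low_eq0 n (Q : {poly M}) : (size Q <= n)%N ->
  (forall k, (k < n)%N -> ip (W lam) Q (P k) = 0) -> Q = 0.
Proof.
elim: n Q => [|n IH] Q sQ oQ.
  by apply/eqP; rewrite -size_poly_eq0 -leqn0.
case: hP => mP oP; have [monP sP] := mP n.
have Q0 : Q - (Q`_n)%:P * P n = 0.
  apply: IH => [|k kn].
    apply/leq_sizeP => k nk; rewrite coefB coefCM.
    have [->|kn] := eqVneq k n.
      by have /monicP := monP; rewrite lead_coefE sP => ->; rewrite mulr1 subrr.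
    have {nk kn}nk : (n < k)%N by rewrite ltn_neqAle eq_sym kn.
    have Pk : (P n)`_k = 0 by rewrite nth_default ?sP.
    by rewrite Pk (nth_default 0 (leq_trans sQ nk)) mulr0 subr0.
  by rewrite ipBl (oQ k (leqW kn)) oP ?gtn_eqF // mulr0 subr0.
have /eqP := oQ n (ltnSn n).
have QE : Q = 0 - (- Q`_n)%:P * P n.
  by rewrite sub0r polyCN mulNr opprK; apply/eqP; rewrite -subr_eq0 Q0.
have ip0 : ip (W lam) (0 : {poly M}) (P n) = 0.
  by have := ipBl lam 0 0 (P n) 1; rewrite mul1r subrr mulr0 subr0.
rewrite QE ipBl ip0 sub0r mulNr opprK => /eqP h0.
have -> : Q`_n = 0 by rewrite -[Q`_n](mulrK (sqnorm_unit n)) h0 mul0r.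
by rewrite oppr0 mul0r subr0.
Qed.

Lemma monic_rodrigues n : P n = (lead n lam)^-1%:P * rod n lam.
Proof.
case: hP => mP oP; have [monP sP] := mP n.
have [sr lr] := rodrigues_lead n lam.
have ur := rod_lead_unit n lam.
apply/eqP; rewrite -subr_eq0; apply/eqP/(@orth_low_eq0 n) => [|k kn].
  apply/leq_sizeP => k nk; rewrite coefB coefCM.
  have [->|kn] := eqVneq k n.
    by have /monicP := monP; rewrite lead_coefE sP lr mulVr // => ->; rewrite subrr.
  have {nk kn}nk : (n < k)%N by rewrite ltn_neqAle eq_sym kn.
  have Pk : (P n)`_k = 0 by rewrite nth_default ?sP.
  by rewrite Pk (nth_default 0 (leq_trans sr nk)) mulr0 subr0.
have [_ sPk] := mP k.
rewrite ipBl oP ?gtn_eqF // ip_rodrigues ?sPk 1?ltnW //.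
by rewrite nth_default ?sPk // trmx0 map_mx0 mulr0 scaler0 mulr0 subr0.
Qed.

Lemma sqnorm_rodrigues n : sqnorm a mu lam P n =
  ((-1) ^+ n * n`!%:R) *: ((lead n lam)^-1 * total_weight (n + lam)).
Proof.
case: hP => mP oP; have [monP sP] := mP n.
have ip0 : ip (W lam) (0 : {poly M}) (P n) = 0.
  by have := ipBl lam 0 0 (P n) 1; rewrite mul1r subrr mulr0 subr0.
rewrite /sqnorm {1}monic_rodrigues -[_%:P * _]opprK -mulNr -polyCN -[- _]sub0r.
rewrite ipBl ip0 sub0r mulNr opprK ip_rodrigues ?sP //.
have -> : (P n)`_n = 1 by have /monicP := monP; rewrite lead_coefE sP.
by rewrite trmxC1 mulr1 scal_r.
Qed.

Lemma charlier_at0 n :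
  u ^- (n + lam) * L * (P n).[0] =
  (- ac) ^+ n *: ((1 + cA (n + lam)) ^+ n * u ^- lam * L).
Proof.
rewrite monic_rodrigues -monic_rod_at0 -[0]/(0%:R) horner_natM hornerC.
by [].
Qed.

Lemma dual_weightE n : dual_weight a mu lam P n =
  toC (a ^+ (2 * n)) *:
    (L^t* * (1 + A^t*) ^- lam * (1 + (cA (n + lam))^t*) ^+ n * (D n)^-1
      * (1 + cA (n + lam)) ^+ n * u ^- lam * L).
Proof.
have at0 := charlier_at0 n.
have -> : dual_weight a mu lam P n =
    (Y n * (P n).[0])^t* * (D n)^-1 * (Y n * (P n).[0]).
  rewrite /dual_weight sqnorm_inv; move: (Y n) (P n).[0] (D n)^-1 => y p d.
  by rewrite trmxCM !mulrA.
rewrite at0 trmxCZ scal_l scal_r scal_l scalerA; congr (_ *: _).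
  rewrite rmorphXn rmorphN /= toC_conj -exprMn mulrNN -expr2 -exprM -toCX.
  by rewrite mulnC.
have uu := upow_unit lam.
rewrite !trmxCM trmxCX trmxCD trmxC1 (trmxCV uu) trmxCX -trmxC_u.
by rewrite !mulrA.
Qed.

Lemma D_total_weight n : D n = (2 ^+ n * n`!%:R) *:
  ((E n lam)^-1 * (Y n * total_weight (n + lam) * (Y n)^t*)).
Proof.
have -> : D n = Y n * sqnorm a mu lam P n * (Y n)^t*.
  rewrite sqnormE; move: (Y n) (D n) (Y_unit n) => y d uy.
  by rewrite !mulrA (mulrV uy) mul1r (mulrVK (trmxC_unit uy)).
rewrite sqnorm_rodrigues.
rewrite (scaled_swap _ _ _ (rod_lead_inv n lam)); congr (_ *: _).
by rewrite mulrAC -exprMn mulN1r opprK.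
Qed.

Lemma Emx_D_diag n j : ((m - j + (lam + n))`!%:R / (m - j + lam)`!%:R) * D n j j =
  (2 ^+ n * n`!%:R) *
   (Y n * total_weight (n + lam) * (Y n)^t*) j j.
Proof.
have uE := Emx_unit n lam.
have := congr1 (fun X : M => (E n lam * X) j j) (D_total_weight n).
rewrite /= scal_r (mulVKr uE) entZ => <-.
by rewrite EmxE -mulmxE mul_diag_mx !mxE.
Qed.

(** Emx n lam and delta (n + lam) have entries comparable to (n + lam)! up to a
    power of n, so these factorials cancel and n! survives from the iterated
    summation by parts. *)
Lemma D_inv_bound n j : `|(D n j j)^-1| <= toC
  ((m`! * (n + lam + m) ^ m)%:R * (2 / a) ^+ lam * (a^-1 ^+ n / n`!%:R)).
Proof.
have dpos : 0 < delta a (n + lam) j.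
  by rewrite mulr_gt0 ?exprn_gt0 ?divr_gt0 // ltr0n fact_gt0.
set z := (Y n * total_weight (n + lam) * (Y n)^t*) j j.
have zge : toC (delta a (n + lam) j) <= `|z| by exact: total_weight_diag_ge.
pose e : R := (m - j + (lam + n))`!%:R / (m - j + lam)`!%:R.
have epos : 0 < e by rewrite divr_gt0 // ltr0n fact_gt0.
have eD : toC e * D n j j = toC (2 ^+ n * n`!%:R) * z.
  by rewrite !toCM toCX toCV !toC_nat Emx_D_diag.
have npos : 0 < 2 ^+ n * n`!%:R :> R.
  by rewrite mulr_gt0 ?exprn_gt0 // ltr0n fact_gt0.
have -> : (D n j j)^-1 = toC (e / (2 ^+ n * n`!%:R)) * z^-1.
  rewrite toCM toCV -mulrA -invfM -eD invfM mulVKf //.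
  by rewrite toC_eq0 gt_eqF.
rewrite normrM normfV toC_norm gtr0_norm ?divr_gt0 //.
apply: (@le_trans _ _ (toC (e / (2 ^+ n * n`!%:R) * (delta a (n + lam) j)^-1))).
  rewrite [leRHS]toCM ler_wpM2l ?toC_ge0 ?(ltW (divr_gt0 _ _)) // toCV.
  rewrite lef_pV2 // posrE.
    by apply: lt_le_trans zge; rewrite -toC0 toC_lt.
  by rewrite -toC0 toC_lt.
rewrite toC_le.
have dge : (a / 2) ^+ (n + lam) * ((n + lam)`!%:R / m`!%:R) <= delta a (n + lam) j.
  rewrite ler_wpM2l ?exprn_ge0 ?divr_ge0 ?(ltW ha) //.
  rewrite ler_pM ?invr_ge0 // ?ler_nat ?leq_fact ?leq_addr //.
  by rewrite lef_pV2 ?posrE ?ltr0n ?fact_gt0 // ler_nat leq_fact // -ltnS.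
have ele : e <= ((n + lam)`! * (n + lam + m) ^ m)%:R.
  rewrite /e ler_pdivrMr ?ltr0n ?fact_gt0 // -natrM ler_nat.
  apply: leq_trans (leq_pmulr _ (fact_gt0 _)).
  rewrite [(lam + n)%N]addnC [X in (_ <= _ * X ^ _)%N]addnC.
  apply: leq_trans (fact_add_le m (n + lam)).
  by rewrite leq_fact // leq_add2r leq_subr.
have d0pos : 0 < (a / 2) ^+ (n + lam) * ((n + lam)`!%:R / m`!%:R).
  by rewrite mulr_gt0 ?exprn_gt0 ?divr_gt0 ?ltr0n ?fact_gt0.
apply: (@le_trans _ _ (((n + lam)`! * (n + lam + m) ^ m)%:R / (2 ^+ n * n`!%:R)
   * ((a / 2) ^+ (n + lam) * ((n + lam)`!%:R / m`!%:R))^-1)).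
  apply: ler_pM; rewrite ?invr_ge0 ?divr_ge0 ?(ltW dpos) ?(ltW npos) ?(ltW epos) //.
    by rewrite ler_wpM2r // invr_ge0 ltW.
  by rewrite lef_pV2 ?posrE.
rewrite le_eqVlt; apply/orP; left; apply/eqP.
rewrite !natrM !expr_div_n !exprD !exprVn.
by field; rewrite !expf_neq0 ?pnatr_eq0 -?lt0n ?fact_gt0 ?(gt_eqF ha).
Qed.

(** * Decay of the dual weight *)

Lemma growth_D_inv : growth (fun n => a^-1 ^+ n / n`!%:R) (fun n => (D n)^-1).
Proof.
have e0 := @exp_term_ge0 R a^-1; rewrite invr_ge0 in e0; have {}e0 := e0 (ltW ha).
have g : growth (fun n => (2 / a) ^+ lam * (a^-1 ^+ n / n`!%:R)) (fun n => (D n)^-1).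
  (* From n + lam + m <= (lam + m + 1) (n + 1). *)
  exists (m`! * (lam + m).+1 ^ m)%N, m => n i j.
  have [dD pD _] := hD n.
  have [|_ ->] := diag_inv (is_diag_mxE dD) => [k|].
    by rewrite gt_eqF // posdefmx_diag_gt0.
  rewrite !mxE; case: eqP => [_|_]; last first.
    rewrite mulr0n normr0 toC_ge0 mulr_ge0 // mulr_ge0 // exprn_ge0 //.
    by rewrite divr_ge0 // ltW.
  rewrite mulr1n; apply: le_trans (D_inv_bound n i) _; rewrite toC_le.
  rewrite -mulrA ler_wpM2r //.
    by rewrite mulr_ge0 // exprn_ge0 // divr_ge0 // ltW.
  rewrite ler_nat -mulnA leq_mul2l -expnMn leq_wexp2r ?orbT //.
  rewrite -addnA mulSn leq_add ?leqnSn //; exact: leq_pmulr.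
by apply: growth_le g => // n.
Qed.

(** Row by row calA_s is K divided by natural numbers, or zero. *)
Lemma growth_calA : growth (fun=> 1) (fun n => cA (n + lam)).
Proof.
have [K [d hK]] := growth_cst (Jmx R m * (Amx mu)^t*).
exists K, d => n i j; apply: le_trans (hK n i j).
rewrite mxE JmxMl adjA_sqrt; case: ifP => _; last by rewrite normr0.
rewrite -toC_nat -toCM !toC_norm toC_le !normrM ler_wpM2r //.
rewrite ler_piMr // ger0_norm ?invr_ge0 //.
have [->|k0] := posnP (N + (n + lam) - i.+1)%N; first by rewrite invr0.
by rewrite invf_le1 ?ltr0n // ler1n.
Qed.

Lemma calA_nilp s : cA s ^+ N = 0.
Proof.
rewrite -[cA s]trmxCK -trmxCX strict_trig_nilp ?trmx0 ?map_mx0 // => i j ij.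
rewrite !mxE; case: eqP => [e|_]; last exact: rmorph0.
by rewrite e ltnn in ij.
Qed.

Lemma growth_unip_calA : growth (fun=> 1) (fun n => (1 + cA (n + lam)) ^+ n).
Proof. by apply: growth_unip_exp growth_calA => n; exact: calA_nilp. Qed.

Lemma growth_unip_calAN : growth (fun=> 1) (fun n => (1 + cA (n + lam)) ^- n).
Proof. by apply: growth_unip_expN growth_calA => n; exact: calA_nilp. Qed.

Lemma charlier_at0E n : (P n).[0] = (- ac) ^+ n *:
  (L^-1 * u ^+ (n + lam) * ((1 + cA (n + lam)) ^+ n * (u ^- lam * L))).
Proof.
have at0 := charlier_at0 n.
have uu := upow_unit (n + lam); have uL := L0_unit.
have uV : u ^- (n + lam) \is a GRing.unit by rewrite unitrV.
have YV : (Y n)^-1 = L^-1 * u ^+ (n + lam) by rewrite (invrM uV uL) invrK.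
have := Y_unit n; move: (Y n) at0 YV => y at0 <- uy.
apply: (mulrI uy); rewrite at0 scal_r (mulVKr uy).
by rewrite -mulrA.
Qed.

Lemma growth_P0 : growth (fun n => a ^+ n) (fun n => (P n).[0]).
Proof.
have a0 n : 0 <= a ^+ n by rewrite exprn_ge0 // ltW.
have g : growth (fun=> 1) (fun n =>
    L^-1 * u ^+ (n + lam) * ((1 + cA (n + lam)) ^+ n * (u ^- lam * L))).
  apply: growth_polyMl => //; last first.
    by apply: growth_polyMr => //; [exact: growth_unip_calA|exact: growth_cst].
  by apply: growth_polyMl => //; [exact: growth_cst|exact: growth_upow].
apply: eq_growth (growthZ _ (c := fun n => (- ac) ^+ n) (v := fun n => a ^+ n)
  _ g) => // n.
- exact: mulr1.
- by rewrite charlier_at0E.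
- by rewrite normrX normrN toC_norm (ger0_norm (ltW ha)) toCX.
Qed.

Lemma growth_P0_inv : growth (fun n => a^-1 ^+ n) (fun n => (P n).[0]^-1).
Proof.
have g : growth (fun=> 1) (fun n =>
    L^-1 * u ^+ lam * ((1 + cA (n + lam)) ^- n * (u ^- (n + lam) * L))).
  apply: growth_polyMl => //; first exact: growth_cst.
  apply: growth_polyMl => //; first exact: growth_unip_calAN.
  by apply: growth_polyMr => //; [exact: growth_upowN|exact: growth_cst].
apply: eq_growth (growthZ _ (c := fun n => (- ac)^-1 ^+ n)
  (v := fun n => a^-1 ^+ n) _ g) => // n.
- exact: mulr1.
- have uA : (1 + cA (n + lam)) ^+ n \is a GRing.unit.
    by rewrite unitrX //; exact: unip_unit (calA_nilp _).
  have un := upow_unit (n + lam); have ul := upow_unit lam.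
  have uL := L0_unit.
  have k0 : (- ac) ^+ n != 0 by rewrite expf_neq0 // oppr_eq0 ac_neq0.
  by rewrite charlier_at0E (conj_scaled_inv k0 uL un uA ul) exprVn.
- by rewrite exprVn normfV normrX normrN toC_norm (ger0_norm (ltW ha)) -toCX -toCV exprVn.
Qed.

(** The factors a^n and a^-n of P_n(0) and of its inverse cancel. *)
Lemma growth_conj_P0 (X : nat -> M) : growth (fun=> 1) X ->
  growth (fun=> 1) (fun n => (P n).[0]^-1 * X n * (P n).[0]).
Proof.
move=> gX.
have a0 n : 0 <= a ^+ n by rewrite exprn_ge0 // ltW.
have b0 n : 0 <= a^-1 ^+ n by rewrite exprn_ge0 // invr_ge0 ltW.
have g1 := growth_polyMr b0 growth_P0_inv gX.
apply: eq_growth (growthM b0 a0 g1 growth_P0) => // n.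
by rewrite -exprMn mulVf ?expr1n // gt_eqF.
Qed.

Lemma growth_Gamma : growth (fun=> 1) (Gamma a mu lam).
Proof.
have g : growth (fun=> 1) (fun n => n%:R *: - u^-1 + - (lam%:R *: u^-1) : M).
  by apply: growthD => //; [apply: growthMn => //|]; exact: growth_cst.
apply: eq_growth (growthD _ (growth_cst (toC a *: u - Jmx R m)) g) => // n.
by rewrite /Gamma natrD scalerDl scalerN opprD.
Qed.

Lemma growth_Gmx k l : growth (fun=> 1) (fun n => Gmx a mu l (n + k)).
Proof.
have gu : growth (fun=> 1) (fun n => u ^+ (n + k + l)).
  by apply: eq_growth (growth_upow (k + l)) => // n; rewrite addnA.
have gv : growth (fun=> 1) (fun n => u ^- (n + k + l)).
  by apply: eq_growth (growth_upowN (k + l)) => // n; rewrite addnA.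
have gc (B : M) := growth_cst B.
have i0 (n : nat) : 0 <= 1 :> R by [].
have g := growth_polyMr i0 (growth_polyMr i0 (growth_polyMr i0 (growth_polyMr i0 (gc L^-1) gu)
  (gc ((N + l + 1)%:R - Jmx R m))) gv) (gc L).
by apply: eq_growth (growth_polyMl i0 (gc (2^-1)%:M) g) => // n; rewrite -mulmxE mul_scalar_mx.
Qed.

Lemma growth_rho rho :
  [\/ rho = rho1 a mu lam P, rho = rho2 a mu lam P
    | (1 <= lam)%N /\ rho = rho3 a mu lam P] -> growth (fun=> 1) rho.
Proof.
case=> [-> | -> | [_ ->]].
- exact: growth_conj_P0 growth_Gamma.
- apply: growthMn => //; apply: growth_conj_P0.
  by apply: eq_growth (growth_Gmx 0 lam) => n; last rewrite addn0.
- have g : growth (fun=> 1)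
      (fun n => (P n).[0]^-1 * Gmx a mu lam.-1 n.+1 * (P n).[0]).
    apply: growth_conj_P0.
    by apply: eq_growth (growth_Gmx 1 lam.-1) => n; last rewrite addn1.
  apply: eq_growth (growthD _ (growthMn _ g) g) => // n.
  by rewrite /rho3 -natr1 scalerDl scale1r.
Qed.

Lemma growth_dual_weight :
  growth (fun n => a ^+ n / n`!%:R) (dual_weight a mu lam P).
Proof.
have e0 := exp_term_ge0 (ltW ha).
have b0 n : 0 <= a^-1 ^+ n / n`!%:R.
  by apply: exp_term_ge0; rewrite invr_ge0 ltW.
have i0 (n : nat) : 0 <= 1 :> R by [].
have gc (B : M) := growth_cst B.
have gA := growth_unip_calA.
have g := growth_polyMr b0 (growth_polyMr b0 (growth_polyMr b0 (growth_polyMl b0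
  (growth_polyMr i0 (gc (L^t* * (1 + A^t*) ^- lam)) (growth_adj gA))
  growth_D_inv) gA) (gc (u ^- lam))) (gc L).
have g' := growthZ b0 (c := fun n => toC (a ^+ (2 * n)))
  (v := fun n => a ^+ (2 * n)) _ g.
apply: eq_growth (g' _) => // n.
- rewrite mulrA exprVn mul2n -addnn exprD mulfK // expf_neq0 //.
  by rewrite gt_eqF.
- have gAE : ((1 + cA (n + lam)) ^+ n)^t* = (1 + (cA (n + lam))^t*) ^+ n.
    by rewrite trmxCX trmxCD trmxC1.
  by rewrite dual_weightE gAE.
- by rewrite toC_norm ger0_norm // exprn_ge0 // ltW.
Qed.

(** P_n(0) and P_(n+1)(0) contribute a^(2 n + 1) and the inverse norm a^-n / n!. *)
Lemma growth_boundary : growth (fun n => a ^+ n / n`!%:R)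
  (fun n => (P n).[0] * (sqnorm a mu lam P n)^-1 * ((P n.+1).[0])^t*).
Proof.
have e0 := exp_term_ge0 (ltW ha).
have b0 n : 0 <= a^-1 ^+ n / n`!%:R.
  by apply: exp_term_ge0; rewrite invr_ge0 ltW.
have a0 n : 0 <= a ^+ n by rewrite exprn_ge0 // ltW.
have i0 (n : nat) : 0 <= 1 :> R by [].
have gY : growth (fun=> 1) (fun n => u ^- (n + lam) * L).
  by apply: growth_polyMr => //; [exact: growth_upowN|exact: growth_cst].
have gH : growth (fun n => a^-1 ^+ n / n`!%:R) (fun n => (sqnorm a mu lam P n)^-1).
  apply: eq_growth (growth_polyMr b0 (growth_polyMl b0 (growth_adj gY)
    growth_D_inv) gY) => // n.
  by rewrite sqnorm_inv.
have gP := growth_P0.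
have gP1 : growth (fun n => a ^+ n.+1) (fun n => ((P n.+1).[0])^t*).
  exact: growth_adj (growth_shift gP).
have ab0 n : 0 <= a ^+ n * (a^-1 ^+ n / n`!%:R) by rewrite mulr_ge0.
have g := growthM ab0 (fun n => a0 n.+1) (growthM a0 b0 gP gH) gP1.
apply: (growth_le e0 (c := a)) g => n.
rewrite le_eqVlt; apply/orP; left; apply/eqP; rewrite exprVn exprS.
have an0 : a ^+ n != 0 by rewrite expf_neq0 // gt_eqF.
by rewrite (mulrA (a ^+ n)) mulfV // mul1r mulrC -mulrA.
Qed.

End DualWeight.
End Charlier.

Theorem theorem8p7 (R : realType) (m : nat) (a : R) (ha : 0 < a)
    (mu : 'I_m.+1 -> R) (hmu : mu_spec a mu) (lam : nat)
    (P : nat -> {poly 'M[Cplx R]_m.+1})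
    (hP : monic_orthogonal (weight a mu lam) P)
    (D : nat -> 'M[Cplx R]_m.+1) (hD : sqnorm_diagonal a mu lam P D) :
  (forall n : nat,
     dual_weight a mu lam P n =
       toC (a ^+ (2 * n)) *:
         ((L0 a mu)^t* * (1 + (Amx mu)^t*) ^- lam
            * (1 + (calA m a (n + lam))^t*) ^+ n * (D n)^-1
            * (1 + calA m a (n + lam)) ^+ n
            * (1 + Amx mu) ^- lam * L0 a mu)) /\
  (forall rho : nat -> 'M[Cplx R]_m.+1,
     [\/ rho = rho1 a mu lam P, rho = rho2 a mu lam P
       | (1 <= lam)%N /\ rho = rho3 a mu lam P] ->
     (forall F : nat -> 'M[Cplx R]_m.+1, rational_without_poles F ->
        cvgn (series (fun n : nat => F n * dual_weight a mu lam P n))) /\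
     (forall R1 R2 : {poly 'M[Cplx R]_m.+1},
        lhorner R1 (rho n) * (P n).[0] * (sqnorm a mu lam P n)^-1
          * ((P n.+1).[0])^t* * lhorner R2 (rho n) @[n --> \oo]
          --> (0 : 'M[Cplx R]_m.+1))).
Proof.
have e0 := exp_term_ge0 (ltW ha).
split=> [n|rho /(growth_rho ha hmu hP hD) grho]; first exact: dual_weightE.
split=> [F hF|R1 R2].
  apply: (growth_exp_cvg_series (ltW ha)).
  exact: growth_polyMl e0 (growth_rational hF) (growth_dual_weight ha hmu hP hD).
apply: (growth_exp_cvg0 (ltW ha)).
apply: eq_growth (growth_polyMr e0 (growth_polyMl e0 (growth_lhorner R1 grho)
  (growth_boundary ha hmu hP hD)) (growth_lhorner R2 grho)) => // n.
by rewrite !mulrA.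
Qed.
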